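(* Let $\{A_1,\dots,A_m\}$ be a collection of finitely many closed sets in an Asplund space $\mathbb{X}$ such that $A:=\bigcap_{i=1}^mA_i$ is nonempty. Suppose that $\{A_1,\dots,A_m\}$ is subtransversal at $\bar x\in A$. Then there exist $\tau,\delta\in(0,+\infty)$ such that for any $\varepsilon>0$, the inclusion $$\hat N(A,x)\cap\mathbf{B}_{\mathbb{X}^*}\subset\bigcup\Big\{\tau\sum_{i=1}^m\big(\hat N(A_i,x_i)\cap(1+\varepsilon)\mathbf{B}_{\mathbb{X}^*}\big): x_i\in A_i\cap\mathbf{B}(x,\varepsilon),\ i=1,\dots,m\Big\}+\varepsilon\mathbf{B}_{\mathbb{X}^*}$$ holds for all $x\in\mathbf{B}(\bar x,\delta)\cap A$.
   Context: $\mathbb{X}^*$ is the topological dual of $\mathbb{X}$; $\mathbf{B}_{\mathbb{X}^*}$ is the closed unit ball of $\mathbb{X}^*$; $\mathbf{B}(x,r)$ is the open ball in $\mathbb{X}$ with center $x$ and radius $r$; $\mathbf{d}(x,S)=\inf_{y\in S}\|x-y\|$. A real Banach space is Asplund if every continuous convex function on it is Fréchet differentiable at each point of a dense subset. For a closed set $A\subseteq\mathbb{X}$ and $x\in A$, the Fréchet normal cone is $\hat N(A,x)=\{x^*\in\mathbb{X}^*:\limsup_{y\to x,\,y\in A}\frac{\langle x^*,y-x\rangle}{\|y-x\|}\le 0\}$. The collection $\{A_1,\dots,A_m\}$ is subtransversal at $\bar x\in A$ if there exist $\tau,r\in(0,+\infty)$ such that $\mathbf{d}(x,A)\le\tau\sum_{i=1}^m\mathbf{d}(x,A_i)$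 for all $x\in\mathbf{B}(\bar x,r)$. *)

(* Defs.v *)
From HB Require Import structures.
From mathcomp Require Import all_boot all_order all_algebra.
From mathcomp Require Import all_classical all_reals all_analysis.

Set Implicit Arguments.
Unset Strict Implicit.
Unset Printing Implicit Defensive.

Import Order.TTheory GRing.Theory Num.Theory.
Import numFieldNormedType.Exports.

Local Open Scope classical_set_scope.
Local Open Scope ring_scope.

Section dual_space.
Context {R : realType} {X : normedModType R}.

Definition is_dual : {pred X -> R^o} :=
  mem [set f : X -> R^o | linear f /\ continuous f].

Lemma is_dual_submod_closed : submod_closed is_dual.
Proof.
split=> [|a f g]; rewrite !inE.
  by split=> [a u v /=|]; [rewrite scaler0 addr0|exact: cst_continuous].
move=> [lf cf] [lg cg]; split=> [b u v|x].
  rewrite -[LHS]/(a *: f (b *: u + v) + g (b *: u + v)) lf lg.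
  rewrite -[(a *: f + g) u]/(a *: f u + g u) -[(a *: f + g) v]/(a *: f v + g v).
  by rewrite !scalerDr !scalerA mulrC addrACA.
by apply: cvgD; [apply: cvgZr; exact: cf|exact: cg].
Qed.

HB.instance Definition _ :=
  GRing.isSubmodClosed.Build R (X -> R^o) is_dual is_dual_submod_closed.

Record dual := Dual { dual_val :> X -> R^o; dualP : dual_val \in is_dual }.

HB.instance Definition _ := [isSub for dual_val].
HB.instance Definition _ := [Choice of dual by <:].
HB.instance Definition _ := [SubChoice_isSubLmodule of dual by <:].

Implicit Types f g : dual.

Lemma dual_linear f : linear f.
Proof. by have := dualP f; rewrite inE => -[]. Qed.

Lemma dual_continuous f : continuous f.
Proof. by have := dualP f; rewrite inE => -[]. Qed.

HB.instance Definition _ f :=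
  GRing.isLinear.Build R X R^o *:%R f (@dual_linear f).

Definition dual_norm f : R := sup [set `|f x| | x in [set x : X | `|x| <= 1]].

Lemma dual_norm_has_sup f :
  has_sup [set `|f x| | x in [set x : X | `|x| <= 1]].
Proof.
split; first by exists `|f 0|, 0 => //=; rewrite normr0.
have /linear_boundedP [M [_ fM]] : bounded_near f (nbhs (0 : X)).
  exact/linear_bounded_continuous/dual_continuous.
have MM : M < `|M| + 1 by rewrite ltr_pwDr// ler_norm.
exists (`|M| + 1) => _ [x /= x1 <-].
by rewrite (le_trans (fM _ MM x))// ler_piMr// addr_ge0.
Qed.

Lemma dual_norm_ub f (x : X) : `|x| <= 1 -> `|f x| <= dual_norm f.
Proof.
move=> x1; apply: sup_upper_bound; first exact: dual_norm_has_sup.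
by exists x.
Qed.

Lemma dual_norm_le f (c : R) :
  (forall x : X, `|x| <= 1 -> `|f x| <= c) -> dual_norm f <= c.
Proof.
move=> fc; apply: ge_sup => [|_ [x /= x1 <-]]; last exact: fc.
by case: (dual_norm_has_sup f).
Qed.

Lemma dual_norm_ge0 f : 0 <= dual_norm f.
Proof.
by apply: le_trans (dual_norm_ub f (x := 0) _); rewrite ?normr_ge0 ?normr0.
Qed.

Lemma dual_normD f g : dual_norm (f + g) <= dual_norm f + dual_norm g.
Proof.
apply: dual_norm_le => x x1.
by rewrite (le_trans (ler_normD (f x) (g x)))// lerD// dual_norm_ub.
Qed.

Lemma dual_normZ (a : R) f : dual_norm (a *: f) = `|a| * dual_norm f.
Proof.
have le_normZ b h : dual_norm (b *: h) <= `|b| * dual_norm h.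
  apply: dual_norm_le => x x1.
  by rewrite -[(b *: h) x]/(b *: h x) normrZ ler_wpM2l// dual_norm_ub.
have [->|a0] := eqVneq a 0.
  apply/eqP; rewrite normr0 mul0r eq_le dual_norm_ge0 andbT.
  by rewrite (le_trans (le_normZ 0 f))// normr0 mul0r.
apply/eqP; rewrite eq_le le_normZ /=.
have := le_normZ a^-1 (a *: f).
by rewrite scalerA mulVf// scale1r normfV ler_pdivlMl ?normr_gt0.
Qed.

Lemma dual_norm_eq0 f : dual_norm f = 0 -> f = 0.
Proof.
move=> f0; apply/val_inj/funext => x; apply/eqP.
rewrite -normr_le0 -[val f x]/(f x).
have [->|x0] := eqVneq x 0; first by rewrite linear0 normr0.
have := dual_norm_ub f (x := `|x|^-1 *: x).
rewrite f0 linearZ /= !normrZ normfV normr_id mulVf ?normr_eq0//.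
by move=> /(_ (lexx _)); rewrite pmulr_rle0// invr_gt0 normr_gt0.
Qed.

HB.instance Definition _ :=
  Lmodule_isNormed.Build R dual dual_normD dual_normZ dual_norm_eq0.

Lemma dual_normE f : `|f| = dual_norm f.
Proof. by []. Qed.

End dual_space.
Arguments dual {R} X.

Section set_operations.
Context {R : realType} {V : normedModType R}.

Definition closed_unit_ball : set V := [set v | `|v| <= 1].

Definition set_scale (a : R) (S : set V) : set V := [set a *: v | v in S].

Definition set_add (S T : set V) : set V := [set v + w | v in S & w in T].

Definition set_sum (m : nat) (S : 'I_m -> set V) : set V :=
  [set \sum_i v i | v in [set v : 'I_m -> V | forall i, S i (v i)]].

End set_operations.
Arguments closed_unit_ball {R} V.

Section variational_notions.
Context {R : realType} {X : normedModType R}.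

Definition asplund : Prop :=
  forall f : X -> R^o, continuous f -> convex_function (E := X) setT f ->
    dense [set x | differentiable f x].

Definition dist (x : X) (S : set X) : R := inf [set `|x - y| | y in S].

(* The limsup ranges over y in A with y != x, and is -oo (so that the cone is
   the whole dual) when x is an isolated point of A. *)
Definition frechet_normal_cone (A : set X) (x : X) : set (dual X) :=
  [set f | (limf_esup (fun y => (f (y - x) / `|y - x|)%:E)
                      (within A x^') <= 0)%E].

Definition subtransversal (m : nat) (A : 'I_m -> set X) (x0 : X) : Prop :=
  exists tau r : R, [/\ 0 < tau, 0 < r &
    forall x, ball x0 r x ->
      dist x (\bigcap_i A i) <= tau * \sum_i dist x (A i)].

End variational_notions.
Arguments asplund {R} X.

(* Main.v *)
Require Import Defs.
From HB Require Import structures.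
From mathcomp Require Import all_boot all_order all_algebra.
From mathcomp Require Import all_classical all_reals all_analysis.
From mathcomp Require Import lra.

Set Implicit Arguments.
Unset Strict Implicit.
Unset Printing Implicit Defensive.

Import Order.TTheory GRing.Theory Num.Theory.
Import numFieldNormedType.Exports.

Local Open Scope classical_set_scope.
Local Open Scope ring_scope.

(* Subtransversality makes (x, ..., x) a local minimizer, over X x A_1 x ... x A_m,
   of the sublinear function
     -f(y - x) + eta |y - x| + tau sum_i |y - x_i|
   of the increments. It therefore suffices to prove a fuzzy rule for a sublinear
   function s which is nonnegative on C - x0, C closed in W = X^(m+1): some point of
   C near x0 has a Frechet normal whose opposite is dominated by s, up to epsilon.

   - The Asplund property makes the dual of every separable subspace separable. If
     it were not, the unit ball would contain a nonempty set M all of whose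
     nonempty slices are large on the subspace; a minimal sublinear function that
     dominates M on the subspace is differentiable somewhere, hence has small
     slices, and cutting off such a slice contradicts minimality.
   - If (xi_n) is dense for the seminorm |.|_Y of restriction to Y, subtracting
     kappa sum_n 2^-n |f - xi_n|_Y^2 in the support formula s = sup_(f <= s) f
     yields a uniform approximation of s which is Frechet differentiable along Y.
   - Ekeland's iteration, with the norms replaced by such approximations, gives an
     exact minimizer of the smoothed s plus smooth perturbations on the intersection of C and Y,
     hence a Frechet normal relative to that intersection.
   - Y is chosen so that it contains finite certificates of the nonexistence of
     admissible functionals satisfying finitely many of the defining inequalities
     of a Frechet normal; by weak* compactness the normal relative to Y can then be
     replaced by a Frechet normal to C. *)

(** * Sublinear functions and the Hahn-Banach theorem *)

Section sublinear.
Context {R : realType} {V : lmodType R}.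
Implicit Types (p q r s : V -> R) (f g : V -> R).

Definition sublinear q :=
  (forall x y, q (x + y) <= q x + q y) /\
  (forall t x, 0 < t -> q (t *: x) <= t * q x).

Definition is_linear f := forall a x y, f (a *: x + y) = a * f x + f y.

Lemma is_linear0 f : is_linear f -> f 0 = 0.
Proof. by move=> /(_ (-1) 0 0); rewrite scaler0 addr0 mulN1r addNr. Qed.

Lemma is_linearD f x y : is_linear f -> f (x + y) = f x + f y.
Proof. by move=> /(_ 1 x y); rewrite scale1r mul1r. Qed.

Lemma is_linearZ f a x : is_linear f -> f (a *: x) = a * f x.
Proof. by move=> lf; have := lf a x 0; rewrite !addr0 is_linear0// addr0. Qed.

Lemma is_linearN f x : is_linear f -> f (- x) = - f x.
Proof. by move=> lf; rewrite -scaleN1r is_linearZ// mulN1r. Qed.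

Lemma is_linearB f x y : is_linear f -> f (x - y) = f x - f y.
Proof. by move=> lf; rewrite is_linearD// is_linearN. Qed.

Lemma is_linear_sum f (J : Type) (l : seq J) (P : pred J) (F : J -> V) :
  is_linear f ->
  f (\sum_(j <- l | P j) F j) = \sum_(j <- l | P j) f (F j).
Proof.
move=> lf; apply: (big_morph f) => [v w|]; first exact: is_linearD.
exact: is_linear0.
Qed.

Lemma is_linear_add f g : is_linear f -> is_linear g ->
  is_linear (fun x => f x + g x).
Proof. by move=> lf lg a x y; rewrite lf lg mulrDr addrACA. Qed.

Lemma is_linear_scale f c : is_linear f -> is_linear (fun x => c * f x).
Proof. by move=> lf a x y; rewrite lf mulrDr mulrCA. Qed.

Lemma sublinear0 q : sublinear q -> q 0 = 0.
Proof.
case=> _ qZ; have := qZ 2 0 ltac:(lra); have := qZ 2^-1 0 ltac:(lra).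
by rewrite !scaler0; lra.
Qed.

Lemma sublinearZ q t x : sublinear q -> 0 <= t -> q (t *: x) = t * q x.
Proof.
move=> sq; rewrite le_eqVlt => /predU1P[<-|t0].
  by rewrite scale0r mul0r sublinear0.
case: (sq) => _ qZ; apply/eqP; rewrite eq_le qZ//=.
have := qZ t^-1 (t *: x); rewrite invr_gt0 => /(_ t0).
by rewrite scalerA mulVf ?gt_eqF// scale1r ler_pdivlMl.
Qed.

Lemma sublinear_ge q x : sublinear q -> - q (- x) <= q x.
Proof.
move=> sq; have := sq.1 x (- x); rewrite subrr sublinear0//; lra.
Qed.

Lemma is_linear_ge q f x : sublinear q -> is_linear f ->
  (forall z, f z <= q z) -> - q (- x) <= f x.
Proof. by move=> sq lf fq; rewrite lerNl -is_linearN. Qed.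

(** Zorn's lemma applies because the pointwise infimum of a chain is finite, by [sublinear_ge], and
    again sublinear. An empty [G] leads to the Hahn-Banach theorem; a [G] made of values of
    functionals gives the minimal majorant used for Asplund spaces. *)
Lemma exists_minimal_sublinear p (G : V -> R -> Prop) :
  sublinear p -> (forall y a, G y a -> a <= p y) ->
  exists q, [/\ sublinear q, forall x, q x <= p x,
    forall y a, G y a -> a <= q y &
    forall r, sublinear r -> (forall x, r x <= q x) ->
      (forall y a, G y a -> a <= r y) -> forall x, r x = q x].
Proof.
move=> sp Gp.
pose P q := [/\ sublinear q, forall x, q x <= p x &
  forall y a, G y a -> a <= q y].
pose T := {q | P q}.
(* The order is reversed, so that Zorn's maximal elements are minimal functions. *)
pose le (s t : T) := `[< forall x, sval t x <= sval s x >].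
have [] := @Zorn T le.
- by move=> t; apply/asboolP => x.
- move=> r s t /asboolP rs /asboolP st; apply/asboolP => x.
  exact: le_trans (st x) (rs x).
- move=> [s Ps] [t Pt] /asboolP/= st /asboolP/= ts.
  have est : s = t by apply/funext => x; apply/le_anti; rewrite st ts.
  by subst t; congr exist; exact: Prop_irrelevance.
- move=> A totA; have [[t0 At0]|A0] := pselect (exists t, A t); last first.
    have Pp : P p by [].
    by exists (exist _ p Pp) => s As; case: A0; exists s.
  pose B x := [set sval t x | t in A].
  have lB x : has_lbound (B x).
    exists (- p (- x)) => _ [t At <-].
    have [st tp _] := svalP t.
    by apply: le_trans (sublinear_ge _ st); rewrite lerN2.
  have B0 x : B x !=set0 by exists (sval t0 x), t0.
  have totle (s t : T) : A s -> A t ->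
      exists2 u, A u & forall x, sval u x <= sval s x /\ sval u x <= sval t x.
    move=> As At; have [/asboolP st|/asboolP ts] := totA _ _ As At.
      by exists t => // x; split => //; exact: st.
    by exists s => // x; split => //; exact: ts.
  pose m x := inf (B x).
  have mP (t : T) x : A t -> m x <= sval t x.
    by move=> At; apply: (ge_inf (lB x)); exists t.
  have Pm : P m.
    split=> [|x|y a Gya].
    + split=> [x y|t x t_gt0].
        apply/ler_addgt0Pr => e e0; have e2 : 0 < e / 2 by lra.
        have [_ [s As <-] lts] := inf_adherent e2 (conj (B0 x) (lB x)).
        have [_ [t At <-] ltt] := inf_adherent e2 (conj (B0 y) (lB y)).
        have [u Au ule] := totle _ _ As At.
        have [[uD _] _ _] := svalP u.
        have := mP u (x + y) Au; have := uD x y.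
        have [? _] := ule x; have [_ ?] := ule y.
        rewrite /m; lra.
      rewrite -ler_pdivrMl//; apply: lb_le_inf (B0 x) _ => _ [s As <-].
      rewrite ler_pdivrMl//; apply: le_trans (mP s _ As) _.
      by have [[_ sZ] _ _] := svalP s; exact: sZ.
    + by apply: le_trans (mP t0 x At0) _; have [_ tp _] := svalP t0.
    + apply: lb_le_inf (B0 y) _ => _ [s As <-].
      by have [_ _ Gs] := svalP s; exact: Gs.
  by exists (exist _ m Pm) => s As; apply/asboolP => x /=; exact: mP.
move=> [q [sq qp Gq]] qmin; exists q; split=> // r sr rq Gr x.
have Pr : P r by split=> // z; exact: le_trans (rq z) (qp z).
have rT : le (exist _ q (And3 sq qp Gq)) (exist _ r Pr) by apply/asboolP.
by have /(congr1 sval)/= -> := qmin _ rT.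
Qed.

(* The support function of the slice {g <= q linear | g x <= c}. *)
Definition slice q x c : V -> R :=
  fun u => inf [set q (u - t *: x) + t * c | t in [set t | 0 <= t]].

Section slice_properties.
Variables (q : V -> R) (x : V) (c : R).
Hypotheses (sq : sublinear q) (xc : - q (- x) <= c).

Let B u := [set q (u - t *: x) + t * c | t in [set t | 0 <= t]].

Let B0 u : B u !=set0.
Proof. by exists (q (u - 0 *: x) + 0 * c), 0 => /=. Qed.

Let lB u : has_lbound (B u).
Proof.
exists (- q (- u)) => _ [t /= t0 <-].
have := sq.1 (u - t *: x) (- u); rewrite addrAC subrr add0r.
rewrite -scalerN sublinearZ// => h.
have : t * - q (- x) <= t * c by rewrite ler_wpM2l.
lra.
Qed.

Lemma slice_sublinear : sublinear (slice q x c).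
Proof.
have le_slice u t : 0 <= t -> slice q x c u <= q (u - t *: x) + t * c.
  by move=> t0; apply: (ge_inf (lB u)); exists t.
split=> [u v|t u t0].
  apply/ler_addgt0Pr => e e0; have e2 : 0 < e / 2 by lra.
  have [_ [s /= s0 <-] lts] := inf_adherent e2 (conj (B0 u) (lB u)).
  have [_ [t /= t0 <-] ltt] := inf_adherent e2 (conj (B0 v) (lB v)).
  apply: le_trans (le_slice _ _ (addr_ge0 s0 t0)) _.
  have := sq.1 (u - s *: x) (v - t *: x).
  by rewrite addrACA -opprD -scalerDl mulrDl; rewrite /slice; lra.
rewrite -ler_pdivrMl//; apply: lb_le_inf (B0 u) _ => _ [s /= s0 <-].
rewrite ler_pdivrMl//; apply: le_trans (le_slice _ (t * s) _) _.
  by rewrite mulr_ge0// ltW.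
by rewrite -scalerA -scalerBr sublinearZ ?(ltW t0)// mulrDr mulrA.
Qed.

Lemma slice_le u t : 0 <= t -> slice q x c u <= q (u - t *: x) + t * c.
Proof. by move=> t0; apply: (ge_inf (lB u)); exists t. Qed.

Lemma slice_le_base u : slice q x c u <= q u.
Proof.
by apply: le_trans (slice_le _ (lexx 0)) _; rewrite scale0r subr0 mul0r addr0.
Qed.

Lemma slice_le_bound : slice q x c x <= c.
Proof.
apply: le_trans (slice_le _ ler01) _.
by rewrite scale1r subrr sublinear0// mul1r add0r.
Qed.

Lemma is_linear_le_slice g : is_linear g -> (forall u, g u <= q u) ->
  g x <= c -> forall u, g u <= slice q x c u.
Proof.
move=> lg gq gx u; apply: lb_le_inf (B0 u) _ => _ [t /= t0 <-].
have := gq (u - t *: x); rewrite is_linearB// is_linearZ//.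
have : t * g x <= t * c by rewrite ler_wpM2l.
lra.
Qed.

End slice_properties.

(** A minimal sublinear [q] is odd, hence linear: cutting it at [x] at the lowest admissible level
    [- q (- x)] cannot change it, so [q x <= - q (- x)]. *)
Lemma exists_linear_le s : sublinear s ->
  exists2 f, is_linear f & forall x, f x <= s x.
Proof.
move=> ss.
have [//|q [sq qs _ qmin]] :=
  @exists_minimal_sublinear s (fun _ _ => False) ss.
have qN x : q (- x) = - q x.
  have xc : - q (- x) <= - q (- x) by [].
  have := qmin _ (slice_sublinear sq xc) (slice_le_base sq xc).
  move=> /(_ ltac:(by [])) /(_ x) sx.
  have := slice_le_bound sq xc; rewrite sx.
  by have := sublinear_ge x sq; lra.
exists q => // a x y.
have qD u v : q (u + v) = q u + q v.
  apply/le_anti; rewrite sq.1/=.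
  by have := sq.1 (- u) (- v); rewrite -opprD !qN; lra.
rewrite qD; congr (_ + _); have [a0|a0] := leP 0 a; first exact: sublinearZ.
by rewrite -[a]opprK scaleNr qN sublinearZ ?mulNr// oppr_ge0 ltW.
Qed.

(** Cutting [s] at [- x] with level [- s x] forces [f (- x) <= - s x]. *)
Lemma exists_linear_eq s x : sublinear s ->
  exists f, [/\ is_linear f, forall u, f u <= s u & f x = s x].
Proof.
move=> ss; have xc : - s (- - x) <= - s x by rewrite opprK.
have [f lf fs] := exists_linear_le (slice_sublinear ss xc).
have fs' u : f u <= s u by apply: le_trans (fs u) (slice_le_base ss xc u).
exists f; split => //; apply/le_anti; rewrite fs'/=.
have := le_trans (fs _) (slice_le_bound ss xc); rewrite is_linearN//; lra.
Qed.

(** A linear minorant of the infimal convolution of [q] with [f] on [Y] lies below [f] on [Y], and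
    equals it there because [Y] is symmetric. *)
Lemma Hahn_Banach (Y : set V) q f : sublinear q -> is_linear f ->
  Y 0 -> (forall x y, Y x -> Y y -> Y (x + y)) ->
  (forall a x, Y x -> Y (a *: x)) ->
  (forall y, Y y -> f y <= q y) ->
  exists g, [/\ is_linear g, forall x, g x <= q x & forall y, Y y -> g y = f y].
Proof.
move=> sq lf Y0 YD YZ fq.
have YN y : Y y -> Y (- y) by rewrite -scaleN1r; exact: YZ.
pose B x := [set f y + q (x - y) | y in Y].
have B0 x : B x !=set0 by exists (f 0 + q (x - 0)), 0.
have lB x : has_lbound (B x).
  exists (- q (- x)) => _ [y Yy <-].
  have := fq _ (YN _ Yy); rewrite is_linearN//.
  by have := sq.1 (x - y) (- x); rewrite addrAC subrr add0r; lra.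
pose p x := inf (B x).
have pP x y : Y y -> p x <= f y + q (x - y).
  by move=> Yy; apply: (ge_inf (lB x)); exists y.
have sp : sublinear p.
  split=> [x y|t x t0].
    apply/ler_addgt0Pr => e e0; have e2 : 0 < e / 2 by lra.
    have [_ [u Yu <-] ltu] := inf_adherent e2 (conj (B0 x) (lB x)).
    have [_ [v Yv <-] ltv] := inf_adherent e2 (conj (B0 y) (lB y)).
    have := pP (x + y) _ (YD _ _ Yu Yv); rewrite (is_linearD _ _ lf).
    have := sq.1 (x - u) (y - v); rewrite addrACA -opprD.
    rewrite -/(p x) -/(p y) in ltu ltv; lra.
  rewrite -ler_pdivrMl//; apply: lb_le_inf (B0 x) _ => _ [y Yy <-].
  rewrite ler_pdivrMl//; apply: le_trans (pP _ _ (YZ t _ Yy)) _.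
  by rewrite -scalerBr (sublinearZ _ sq (ltW t0)) (is_linearZ _ _ lf) mulrDr.
have [g lg gp] := exists_linear_le sp.
have gf y : Y y -> g y <= f y.
  move=> Yy; apply: le_trans (gp y) (le_trans (pP y y Yy) _).
  by rewrite subrr sublinear0// addr0.
exists g; split => // [x|y Yy].
  apply: le_trans (gp x) (le_trans (pP x 0 Y0) _).
  by rewrite subr0 is_linear0// add0r.
apply/le_anti; rewrite gf//=.
by have := gf _ (YN _ Yy); rewrite !is_linearN// lerN2.
Qed.

End sublinear.

(** * Weak* compactness and countable hulls *)

Section functional_compactness.
Context {R : realType} {V : lmodType R}.

(* Weak* compactness of the set of linear functionals dominated by s, phrased
   for filter bases so that no topology on the dual is needed. *)
Lemma linear_cluster (s : V -> R) (I : Type) (i0 : I) (S : I -> set (V -> R)) :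
  sublinear s ->
  (forall i f, S i f -> is_linear f /\ forall x, f x <= s x) ->
  (forall i, S i !=set0) ->
  (forall i j, exists k, S k `<=` S i /\ S k `<=` S j) ->
  exists f, [/\ is_linear f, forall x, f x <= s x &
    forall i (l : seq V) e, 0 < e ->
      exists2 g, S i g & forall v, v \in l -> `|g v - f v| <= e].
Proof.
move=> ss Ss S0 Sdir.
pose F := filter_from setT S.
have FF : ProperFilter F.
  apply: filter_from_proper => [|i _]; last exact: S0.
  apply: filter_fromT_filter; first by exists i0.
  move=> i j; have [k [ki kj]] := Sdir i j.
  by exists k => g Skg; split; [exact: ki|exact: kj].
have [G [UG FG]] := ultraFilterLemma FF.
have GS i : G (S i) by apply: FG; exists i.
(* Along an ultrafilter refining the base, the values at [v] stay in a compact interval, hence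
   converge; the limits define [f]. *)
have /choice[f fP] (v : V) : exists a, - s (- v) <= a <= s v /\
    forall e, 0 < e -> G [set g | `|g v - a| <= e].
  have GI : G [set g | - s (- v) <= g v <= s v].
    move: (GS i0); apply: filterS => g Sg /=; have [lg gs] := Ss _ _ Sg.
    by rewrite gs andbT; exact: is_linear_ge.
  have [a [/= aI acl]] := @segment_compact R (- s (- v)) (s v)
    (fmap (fun g : V -> R => g v) G) _ ltac:(by []).
  rewrite in_itv/= in aI.
  exists a; split=> // e e0.
  have [//|GnU] := in_ultra_setVsetC [set g : V -> R | `|g v - a| <= e] UG.
  have Ge : G [set g | e < `|g v - a|].
    by move: GnU; apply: filterS => g /= /negP; rewrite -ltNge.
  have [b [/= eb]] :=
    acl [set b | e < `|b - a|] (ball a e) Ge (nbhsx_ballx a e e0).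
  rewrite -ball_normE/= distrC => be.
  by have := lt_trans eb be; rewrite ltxx.
have near_f i (l : seq V) e : 0 < e ->
    exists2 g, S i g & forall v, v \in l -> `|g v - f v| <= e.
  move=> e0.
  suff /filter_ex[g [Sg gl]] :
    G (S i `&` [set g | forall v, v \in l -> `|g v - f v| <= e]) by exists g.
  apply: filterI => //; elim: l => [|v l IH].
    by apply: filterE => g v; rewrite in_nil.
  move: ((fP v).2 e e0) IH; apply: filterS2 => g gv gl u.
  by rewrite in_cons => /predU1P[->//|/gl].
exists f; split=> // [a x y|x]; last by have /andP[] := (fP x).1.
apply/eqP; rewrite -subr_eq0 -normr_le0; apply/ler_addgt0Pr => e e0.
rewrite add0r.
have c0 : 0 < `|a| + 2 by have := normr_ge0 a; lra.
have [g Sg gl] := near_f i0 [:: a *: x + y; x; y] (e / (`|a| + 2))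
  (divr_gt0 e0 c0).
have [lg _] := Ss _ _ Sg.
have g1 := gl (a *: x + y) (mem_head _ _).
have g2 := gl x ltac:(by rewrite !inE eqxx orbT).
have g3 := gl y ltac:(by rewrite !inE eqxx !orbT).
rewrite lg in g1.
have -> : f (a *: x + y) - (a * f x + f y) =
  - (a * g x + g y - f (a *: x + y)) + a * (g x - f x) + (g y - f y).
  by rewrite mulrBr; lra.
apply: le_trans (ler_normD _ _) _; apply: le_trans (lerD (ler_normD _ _) g3) _.
rewrite normrN normrM.
have := ler_wpM2l (normr_ge0 a) g2.
have : (`|a| + 2) * (e / (`|a| + 2)) = e by rewrite mulrC divfK ?gt_eqF.
rewrite [_ * (e / _)]mulrDl; lra.
Qed.

End functional_compactness.

Section hull.
Context {V : Type} {P : countType} (e : nat -> V) (op : P -> V -> V -> V).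

(** A leaf is a generator, a binary node carries the code of an operation, and ill-formed trees get
    the default [e 0]. Trees are countable, so their values can be enumerated. *)
Fixpoint hull_eval (t : GenTree.tree nat) : V :=
  match t with
  | GenTree.Leaf k => e k
  | GenTree.Node n [:: a; b] =>
      if unpickle n is Some p then op p (hull_eval a) (hull_eval b) else e 0
  | _ => e 0
  end.

Lemma countable_hull : exists d : nat -> V,
  (forall k, exists j, d j = e k) /\
  (forall p k l, exists j, d j = op p (d k) (d l)).
Proof.
pose d n := if @unpickle (GenTree.tree nat) n is Some t then hull_eval t
            else e 0.
have dE t : d (pickle t) = hull_eval t by rewrite /d pickleK.
have Ed k : exists t, d k = hull_eval t.
  by rewrite /d; case: unpickle => [t|]; [exists t|exists (GenTree.Leaf 0)].
exists d; split=> [k|p k l].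
  by exists (pickle (GenTree.Leaf k)); rewrite dE.
have [[a ->] [b ->]] := (Ed k, Ed l).
by exists (pickle (GenTree.Node (pickle p) [:: a; b])); rewrite dE/= pickleK.
Qed.

End hull.

Lemma seq_min_gt0 {R : realType} (T : eqType) (l : seq T) (P : T -> Prop)
    (v : T -> R) : (forall x, P x -> 0 < v x) ->
  exists2 r, 0 < r & forall x, x \in l -> P x -> r <= v x.
Proof.
move=> v0; elim: l => [|y l [r r0 rl]]; first by exists 1.
have [Py|nPy] := pselect (P y).
  exists (Num.min r (v y)); first by rewrite lt_min r0 v0.
  move=> x; rewrite in_cons ge_min => /predU1P[->|xl Px].
    by rewrite lexx orbT.
  by rewrite rl.
exists r => // x; rewrite in_cons => /predU1P[->//|]; exact: rl.
Qed.

(** * Separable duals in Asplund spaces *)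

Section contractive.
Context {R : realType} {V : normedModType R}.

(** The closed unit ball of the dual; the bound at [- x] makes it two-sided. *)
Definition contractive (f : V -> R) := is_linear f /\ forall x, f x <= `|x|.

Lemma contractive_norm f x : contractive f -> `|f x| <= `|x|.
Proof.
case=> lf f1; rewrite ler_norml f1 andbT lerNl -is_linearN//.
by rewrite -[leRHS]normrN.
Qed.

Lemma contractive0 : contractive (fun=> 0).
Proof. by split=> [a x y|x]; [rewrite mulr0 addr0|exact: normr_ge0]. Qed.

Lemma sublinear_norm c : 0 <= c -> sublinear (fun x : V => c * `|x|).
Proof.
move=> c0; split=> [x y|t x t0].
  by rewrite -mulrDr ler_wpM2l// ler_normD.
by rewrite normrZ gtr0_norm// mulrCA.
Qed.

Lemma sublinear_lipschitz (q : V -> R) L : sublinear q ->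
  (forall x, q x <= L * `|x|) -> forall x y, q x - q y <= L * `|x - y|.
Proof.
move=> sq qL x y; have := sq.1 (x - y) y; rewrite subrK => h.
by have := qL (x - y); lra.
Qed.

Lemma is_linear_bound_ball (f : V -> R) d c : is_linear f -> 0 < d ->
  (forall x, `|x| <= d -> f x <= c * d) -> forall x, f x <= c * `|x|.
Proof.
move=> lf d0 fc x; have [->|x0] := eqVneq x 0.
  by rewrite is_linear0// normr0 mulr0.
have nx0 : 0 < `|x| by rewrite normr_gt0.
have := fc ((d / `|x|) *: x).
rewrite normrZ gtr0_norm ?divr_gt0// divfK ?gt_eqF// lexx => /(_ isT).
rewrite is_linearZ// mulrAC ler_pdivrMr// [leRHS]mulrAC.
by rewrite [d * f x]mulrC ler_pM2r.
Qed.

End contractive.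

(* Says that every separable subspace of V has a separable dual. *)
Definition separable_dual_restrictions {R : realType} (V : normedModType R) :=
  forall e : nat -> V, exists xi : nat -> V -> R,
    (forall n, contractive (xi n)) /\
    forall f, contractive f -> forall eps, 0 < eps ->
      exists n, forall k, `|f (e k) - xi n (e k)| <= eps * `|e k|.

Lemma exists_natSinv_lt {R : realType} (eps : R) : 0 < eps ->
  exists n : nat, n.+1%:R^-1 < eps.
Proof.
move=> eps0; exists (Num.truncn eps^-1).
by rewrite -[ltRHS]invrK ltf_pV2 ?posrE ?invr_gt0// truncnS_gt.
Qed.

Section asplund_separable.
Context {R : realType} {X : normedModType R}.
Hypothesis asplundX : asplund X.

(** This is Smulian's criterion: at a point of Frechet differentiability of [q], every linear
    minorant that almost attains [q x] is uniformly close to the derivative. *)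
Lemma asplund_sublinear_slice (q : X -> R) : sublinear q ->
  (forall x, q x <= `|x|) -> forall eps, 0 < eps -> exists x a, 0 < a /\
  forall f g, is_linear f -> is_linear g -> (forall u, f u <= q u) ->
    (forall u, g u <= q u) -> q x - a < f x -> q x - a < g x ->
    forall u, `|f u - g u| <= eps * `|u|.
Proof.
move=> sq q1 eps eps0.
have lip x y : q x - q y <= `|x - y|.
  by rewrite -[leRHS]mul1r; apply: sublinear_lipschitz => // z; rewrite mul1r.
have cq : continuous (q : X -> R^o).
  move=> x; apply/cvgrPdist_lt => e e0.
  near=> y; have xy : `|x - y| < e.
    by near: y; apply: cvgr_dist_lt => //; exact: cvg_id.
  apply: le_lt_trans xy; rewrite ler_norml lip andbT lerNl opprB.
  by rewrite distrC lip.
have vq : convex_function (E := X) setT (q : X -> R^o).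
  move=> t x y _ _; rewrite convRE.
  apply: le_trans (sq.1 _ _) _.
  by rewrite !(sublinearZ _ sq)// unstable.onem_ge0.
have [x [_ /= dx]] := asplundX cq vq (ex_intro _ 0 I) openT.
have e8 : 0 < eps / 8 by lra.
have /eqaddoP/(_ _ e8)/nbhs_ballP[d /= d0 dP] := diff_locally dx.
pose l h : R := 'd (q : X -> R^o) x h.
have ll : is_linear l by move=> a u v; rewrite /l linearP.
have ql h : `|h| <= d / 2 -> q (x + h) <= q x + l h + eps / 8 * (d / 2).
  move=> hd; have /dP : ball (0 : X) d h.
    by rewrite -ball_normE/= sub0r normrN; lra.
  rewrite /= -[X in `|X|]/(q (h + x) - (q x + l h)) addrC => /ler_normlW.
  by have := ler_wpM2l (ltW e8) hd; rewrite /= ![x + h]addrC; lra.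
(* On the ball of radius [d / 2] this slack and the linearization error are equal and add up to
   [eps / 4 * (d / 2)], which bounds [f - l] there. *)
exists x, (eps / 8 * (d / 2)); split; first by rewrite mulr_gt0; lra.
have key f : is_linear f -> (forall u, f u <= q u) ->
    q x - eps / 8 * (d / 2) < f x -> forall u, `|f u - l u| <= eps / 4 * `|u|.
  move=> lf fq fx.
  have lfl : is_linear (fun u => f u - l u).
    by move=> a u v; rewrite lf ll; lra.
  have le u : f u - l u <= eps / 4 * `|u|.
    apply: (is_linear_bound_ball lfl (d := d / 2)); first by lra.
    move=> h /ql; have := fq (x + h); rewrite (is_linearD _ _ lf); lra.
  move=> u; rewrite ler_norml le andbT lerNl -(is_linearN _ lfl).
  by rewrite -[`|u|]normrN le.
move=> f g lf lg fq gq fx gx u.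
have -> : f u - g u = (f u - l u) - (g u - l u) by lra.
apply: le_trans (ler_normB _ _) _.
have := key f lf fq fx u; have := key g lg gq gx u.
have := mulr_ge0 (ltW eps0) (normr_ge0 u); lra.
Unshelve. all: by end_near. Qed.

Lemma asplund_separable_dual_restrictions : separable_dual_restrictions X.
Proof.
move=> e.
(* [None] codes the sum and [Some r] a rational multiple, so the closure [Y] of the range of [d] is
   a linear subspace. *)
pose op (p : option rat) (x y : X) := if p is Some r then ratr r *: x else x + y.
have [d [ed dop]] := countable_hull e op.
have dD k l : exists j, d j = d k + d l by exact: (dop None).
have dZ (r : rat) k : exists j, d j = ratr r *: d k by exact: (dop (Some r) k k).
pose Y := [set y | forall h, 0 < h -> exists k, `|y - d k| < h].
have Yd k : Y (d k) by move=> h h0; exists k; rewrite subrr normr0.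
have Y0 : Y 0 by have [j dj] := dZ 0 0; rewrite -(scale0r (d 0)) -(rmorph0 ratr) -dj.
have YD x y : Y x -> Y y -> Y (x + y).
  move=> Yx Yy h h0; have h2 : 0 < h / 2 by lra.
  have [[k xk] [l yl]] := (Yx _ h2, Yy _ h2).
  have [j dj] := dD k l; exists j; rewrite dj opprD addrACA.
  by apply: le_lt_trans (ler_normD _ _) _; lra.
have YZ a x : Y x -> Y (a *: x).
  move=> Yx h h0; have x1 : 0 < `|x| + 1 by rewrite ltr_wpDl.
  have [c c0 cE] : exists2 c, 0 < c & c * (`|x| + 1) = h / 2.
    by exists (h / 2 / (`|x| + 1)); rewrite ?divfK ?gt_eqF// !divr_gt0.
  have [r] := @rat_in_itvoo R (a - c) a ltac:(by rewrite gtrBl).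
  rewrite in_itv/= => /andP[ar ra].
  have r1 : 0 < `|ratr r : R| + 1 by rewrite ltr_wpDl.
  have [b b0 bE] : exists2 b, 0 < b & (`|ratr r : R| + 1) * b = h / 2.
    exists (h / 2 / (`|ratr r : R| + 1)); first by rewrite !divr_gt0.
    by rewrite mulrC divfK ?gt_eqF.
  have [k /ltW xk] := Yx b b0.
  have [j dj] := dZ r k; exists j; rewrite dj.
  have -> : a *: x - ratr r *: d k = (a - ratr r) *: x + ratr r *: (x - d k).
    by rewrite scalerBl scalerBr addrA subrK.
  apply: le_lt_trans (ler_normD _ _) _.
  rewrite (normrZ (a - _)) (normrZ (ratr r)).
  have ac : `|a - ratr r| <= c by rewrite ger0_norm; lra.
  have := ler_wpM2r (normr_ge0 x) ac.
  have := ler_wpM2l (normr_ge0 (ratr r : R)) xk.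
  by rewrite mulrDr mulr1 in cE; rewrite mulrDl mul1r in bE; lra.
pose near_on eps (f g : X -> R) := forall k, `|f (d k) - g (d k)| <= eps * `|d k|.
pose cov eps (S : set (X -> R)) := exists xi : nat -> X -> R,
  (forall n, contractive (xi n)) /\
  forall f, S f -> exists n, near_on eps f (xi n).
suff covK eps : 0 < eps -> cov eps contractive.
  have /choice[xi xiP] : forall j : nat, exists xi : nat -> X -> R,
      (forall n, contractive (xi n)) /\
      forall f, contractive f -> exists n, near_on j.+1%:R^-1 f (xi n).
    by move=> j; exact: covK.
  exists (fun n => if unpickle n is Some (j, m) then xi j m else fun=> 0).
  split=> [n|f cf eps eps0].
    by case: unpickle => [[j m]|]; [exact: (xiP j).1|exact: contractive0].
  have [j jeps] := exists_natSinv_lt eps0.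
  have [m fm] := (xiP j).2 f cf.
  exists (pickle (j, m)) => k; rewrite pickleK.
  have [i <-] := ed k; apply: le_trans (fm i) _.
  by rewrite ler_wpM2r// ltW.
move=> eps0; apply: contrapT => ncov.
pose half k (a : rat) := [set f : X -> R | contractive f /\ ratr a < f (d k)].
(* What remains of the unit ball once every slice by a rational half-space at some [d k] that can be
   covered has been deleted; only countably many slices are deleted. *)
pose M := [set f : X -> R | contractive f /\
  forall k a, cov eps (half k a) -> ~ half k a f].
(* The countable covers of the deleted slices, together with the single functional [f0] for the part
   in [M], form one countable cover. *)
have covM (S : set (X -> R)) f0 : S `<=` contractive -> contractive f0 ->
    (forall g, S g -> M g -> near_on eps g f0) -> cov eps S.
  move=> Sc cf0 Sf0.
  have /choice[Xi XiP] (p : nat * rat) : exists xi : nat -> X -> R,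
      (forall n, contractive (xi n)) /\
      (cov eps (half p.1 p.2) ->
         forall f, half p.1 p.2 f -> exists n, near_on eps f (xi n)).
    have [[xi [cxi xif]]|nc] := pselect (cov eps (half p.1 p.2)).
      by exists xi.
    by exists (fun _ _ => 0); split=> // n; exact: contractive0.
  exists (fun n => if unpickle n is Some (Some (p, m)) then Xi p m else f0).
  split; first by move=> n; case: unpickle => [[[p m]|]|] //; exact: (XiP p).1.
  move=> g Sg; have [Mg|nMg] := pselect (M g).
    exists (pickle (@None (nat * rat * nat))); rewrite pickleK.
    exact: Sf0.
  have [k [a [ca ha]]] : exists k a, cov eps (half k a) /\ half k a g.
    apply: contrapT => no; apply: nMg; split; first exact: Sc.
    by move=> k a ca ha; apply: no; exists k, a.
  have [m gm] := (XiP (k, a)).2 ca g ha.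
  by exists (pickle (Some (k, a, m))); rewrite pickleK.
have Mfar k a f : M f -> ratr a < f (d k) ->
    exists g, [/\ M g, ratr a < g (d k) & ~ near_on eps g f].
  move=> Mf fa; apply: contrapT => no.
  apply: (Mf.2 k a _ (conj Mf.1 fa)); apply: (covM _ f) => //.
  - by move=> g [].
  - exact: Mf.1.
  - by move=> g [_ ga] Mg; apply: contrapT => gf; apply: no; exists g.
have [f0 Mf0] : M !=set0.
  apply: contrapT => M0; apply: ncov.
  apply: (covM _ (fun=> 0)) => //; first exact: contractive0.
  by move=> g _ Mg; case: M0; exists g.
pose G y a := exists k f, [/\ M f, y = d k & a = f (d k)].
have [|q [sq q1 Gq qmin]] := @exists_minimal_sublinear R X _ G
  (sublinear_norm (V := X) ler01).
  by move=> _ _ [k [f [[[_ f1] _] -> ->]]]; rewrite mul1r.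
have q1' x : q x <= `|x| by rewrite -[leRHS]mul1r.
have [x [a [a0 slice_small]]] := asplund_sublinear_slice sq q1' eps0.
(* Continuity carries the domination by [q] from the points [d k] to [Y], and Hahn-Banach then
   extends the restriction below [q] on the whole space. *)
have ext f : M f -> exists g, [/\ is_linear g, forall u, g u <= q u &
    forall k, g (d k) = f (d k)].
  move=> Mf; have [lf f1] := Mf.1.
  have fq y : Y y -> f y <= q y.
    move=> Yy; apply/ler_addgt0Pr => h h0.
    have [k yk] := Yy (h / 2) ltac:(lra).
    have := f1 (y - d k); rewrite is_linearB//.
    have : f (d k) <= q (d k) by apply: Gq; exists k, f.
    have := sublinear_lipschitz (L := 1) sq _ (d k) y.
    rewrite mul1r (distrC (d k)).
    by move=> /(_ ltac:(by move=> z; rewrite mul1r)); lra.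
  have [g [lg gq gf]] := Hahn_Banach sq lf Y0 YD YZ fq.
  by exists g; split=> // k; exact: gf.
(* A nonempty slice of [M] contains two functionals that are far apart on [d]; their extensions
   cannot both lie in the small slice of [q] at [x]. *)
have contra f k b : M f -> ratr b < f (d k) ->
    (forall g, is_linear g -> (forall u, g u <= q u) ->
       ratr b < g (d k) -> q x - a < g x) -> False.
  move=> Mf fb in_slice; have [f' [Mf' fb' farf]] := Mfar k b f Mf fb.
  have [[g [lg gq gf]] [g' [lg' gq' gf']]] := (ext f Mf, ext f' Mf').
  apply: farf => i; rewrite -gf -gf'; apply: slice_small => //.
    by apply: in_slice => //; rewrite gf'.
  by apply: in_slice => //; rewrite gf.
(* If [q x - a] is below [- q (- x)], all linear minorants of [q] are in the small slice, and any
   nonempty slice of [M] will do. *)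
have [xa|xa] := leP (- q (- x)) (q x - a); last first.
  have [b] := @rat_in_itvoo R (f0 (d 0) - 1) (f0 (d 0)) ltac:(lra).
  rewrite in_itv/= => /andP[_ fb].
  apply: (contra f0 0 b) => // g lg gq _.
  by apply: lt_le_trans xa _; exact: is_linear_ge.
(* Cutting off the small slice lowers [q] at [x], so by minimality the result no longer dominates
   [M]. A rational [b] between the two values then yields a slice of [M] inside the small one. *)
have [k [f [Mf rf]]] : exists k f, M f /\ slice q x (q x - a) (d k) < f (d k).
  apply: contrapT => no.
  have := qmin _ (slice_sublinear sq xa) (slice_le_base sq xa) _ x.
  have := slice_le_bound sq xa.
  suff Gr y b : G y b -> b <= slice q x (q x - a) y.
    by move=> h /(_ Gr); lra.
  move=> [k [f [Mf -> ->]]]; rewrite leNgt; apply/negP => rf.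
  by apply: no; exists k, f.
have [b] := rat_in_itvoo rf; rewrite in_itv/= => /andP[rb fb].
apply: (contra f k b) => // g lg gq gb; rewrite ltNge; apply/negP => gx.
have := is_linear_le_slice lg gq gx (d k); lra.
Qed.

End asplund_separable.

(** * Smoothing along a subspace with separable dual *)

Section smoothing.
Context {R : realType} {V : normedModType R}.
Variables (s : V -> R) (L : R) (Y : set V) (xi : nat -> V -> R) (B kappa : R).

Let U f := is_linear f /\ forall x, f x <= s x.

Hypotheses (ss : sublinear s) (L0 : 0 <= L) (sL : forall x, s x <= L * `|x|).
Hypotheses (Y0 : Y 0) (B0 : 0 < B) (kappa0 : 0 < kappa).
Hypothesis xiB : forall f n y, U f -> Y y -> `|f y - xi n y| <= B * `|y|.
Hypothesis xi_dense : forall f eps, U f -> 0 < eps ->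
  exists n, forall y, Y y -> `|f y - xi n y| <= eps * `|y|.

(** The distance from [f] to [xi n] in the dual seminorm of restriction to [Y]; the point [0]
    contributes [0], since [0^-1 = 0]. *)
Let a n (f : V -> R) := sup [set `|f y - xi n y| / `|y| | y in Y].

Let a_has_sup n f : U f -> has_sup [set `|f y - xi n y| / `|y| | y in Y].
Proof.
move=> Uf; split; first by exists (`|f 0 - xi n 0| / `|0 : V|), 0.
exists B => _ [y Yy <-]; have [->|y0] := eqVneq y 0.
  by rewrite normr0 invr0 mulr0 ltW.
by rewrite ler_pdivrMr ?normr_gt0//; exact: xiB.
Qed.

Let aP n f y : U f -> Y y -> `|f y - xi n y| <= a n f * `|y|.
Proof.
move=> Uf Yy; have [->|y0] := eqVneq y 0.
  by rewrite normr0 mulr0; have := xiB n Uf Y0; rewrite normr0 mulr0.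
rewrite -ler_pdivrMr ?normr_gt0//; apply: ub_le_sup.
  by have [] := a_has_sup n Uf.
by exists y.
Qed.

Let a_le n f c : 0 <= c -> (forall y, Y y -> `|f y - xi n y| <= c * `|y|) ->
  a n f <= c.
Proof.
move=> c0 fc; apply: ge_sup => [|_ [y Yy <-]].
  by exists (`|f 0 - xi n 0| / `|0 : V|), 0.
have [->|y0] := eqVneq y 0; first by rewrite normr0 invr0 mulr0.
by rewrite ler_pdivrMr ?normr_gt0//; exact: fc.
Qed.

Let a_ge0 n f : U f -> 0 <= a n f.
Proof.
move=> Uf; apply: le_trans (_ : `|f 0 - xi n 0| / `|0 : V| <= _).
  by rewrite divr_ge0.
by apply: ub_le_sup; [have [] := a_has_sup n Uf|exists 0].
Qed.

Let a_leB n f : U f -> a n f <= B.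
Proof. by move=> Uf; apply: a_le => [|y Yy]; [exact: ltW|exact: xiB]. Qed.

Let w n : R := 2^-1 ^+ n.+1.

Let w0 n : 0 < w n. Proof. by rewrite exprn_gt0// invr_gt0. Qed.

Let sumw N : \sum_(j < N) w j <= 1.
Proof.
suff -> : \sum_(j < N) w j = 1 - 2^-1 ^+ N by rewrite gerBl exprn_ge0.
elim: N => [|N IH]; first by rewrite big_ord0 expr0 subrr.
rewrite big_ord_recr/= IH /w exprS; lra.
Qed.

Let hN N f := \sum_(j < N) w j * a j f ^+ 2.
Let h f := sup [set hN N f | N in [set: nat]].
(** Since [h] is at most [B ^+ 2], the penalty [c * h] costs at most [kappa]. *)
Let c := kappa / B ^+ 2.

Let c0 : 0 < c. Proof. by rewrite divr_gt0// exprn_gt0. Qed.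

Let hN_leB N f : U f -> hN N f <= B ^+ 2.
Proof.
move=> Uf; apply: le_trans (_ : \sum_(j < N) w j * B ^+ 2 <= _).
  apply: ler_sum => j _; rewrite ler_pM2l// ler_sqr ?nnegrE ?a_ge0 ?(ltW B0)//.
  exact: a_leB.
by rewrite -mulr_suml ler_piMl// exprn_ge0// ltW.
Qed.

Let h_has_sup f : U f -> has_sup [set hN N f | N in [set: nat]].
Proof.
by move=> Uf; split; [exists (hN 0 f), 0|exists (B ^+ 2) => _ [N _ <-]; exact: hN_leB].
Qed.

Let hN_le N f : U f -> hN N f <= h f.
Proof. by move=> Uf; apply: ub_le_sup; [have [] := h_has_sup Uf|exists N]. Qed.

Let h_le f b : (forall N, hN N f <= b) -> h f <= b.
Proof. by move=> fb; apply: ge_sup => [|_ [N _ <-]//]; exists (hN 0 f), 0. Qed.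

Let h_ge0 f : U f -> 0 <= h f.
Proof. by move=> Uf; have := hN_le 0 Uf; rewrite /hN big_ord0. Qed.

Let val z f := f z - c * h f.
Let q z := sup [set val z f | f in U].

Let U0 : U !=set0.
Proof. by have [f lf fs] := exists_linear_le ss; exists f. Qed.

Let val_le z f : U f -> val z f <= f z.
Proof. by move=> Uf; rewrite gerBl mulr_ge0 ?h_ge0// ltW. Qed.

Let q_has_sup z : has_sup [set val z f | f in U].
Proof.
split; first by have [f Uf] := U0; exists (val z f), f.
exists (s z) => _ [f Uf <-]; exact: le_trans (val_le z Uf) (Uf.2 z).
Qed.

Let qP z f : U f -> val z f <= q z.
Proof. by move=> Uf; apply: ub_le_sup; [have [] := q_has_sup z|exists f]. Qed.

Let q_le z b : (forall f, U f -> val z f <= b) -> q z <= b.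
Proof.
by move=> fb; apply: ge_sup => [|_ [f Uf <-]]; [case: (q_has_sup z)|exact: fb].
Qed.

Let q_near z e : 0 < e -> exists2 f, U f & q z - e < val z f.
Proof.
by move=> e0; have [_ [f Uf <-] lt] := sup_adherent e0 (q_has_sup z); exists f.
Qed.

Let q_les z : q z <= s z.
Proof. by apply: q_le => f Uf; exact: le_trans (val_le z Uf) (Uf.2 z). Qed.

Let q_ges z : s z - kappa <= q z.
Proof.
have [f [lf fs fz]] := exists_linear_eq z ss.
have Uf : U f by [].
apply: le_trans (qP z Uf); rewrite /val fz lerD2l lerN2.
have -> : kappa = c * B ^+ 2 by rewrite /c divfK// gt_eqF// exprn_gt0.
by rewrite ler_pM2l//; apply: h_le => N; exact: hN_leB.
Qed.

Let q_lip z u : q (z + u) <= q z + s u.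
Proof.
apply: q_le => f Uf; have := qP z Uf; have := Uf.2 u.
by rewrite /val (is_linearD _ _ Uf.1); lra.
Qed.

Let mid f g : V -> R := fun x => 2^-1 * f x + 2^-1 * g x.

Let U_mid f g : U f -> U g -> U (mid f g).
Proof.
move=> [lf fs] [lg gs]; split=> [|x].
  by apply: is_linear_add; exact: is_linear_scale.
by have := fs x; have := gs x; rewrite /mid; lra.
Qed.

Let a_mid n f g : U f -> U g -> a n (mid f g) <= 2^-1 * a n f + 2^-1 * a n g.
Proof.
move=> Uf Ug; apply: a_le => [|y Yy].
  by rewrite addr_ge0// mulr_ge0 ?a_ge0// invr_ge0.
have -> : mid f g y - xi n y = 2^-1 * (f y - xi n y) + 2^-1 * (g y - xi n y).
  by rewrite /mid; lra.
apply: le_trans (ler_normD _ _) _; rewrite !normrM ger0_norm ?invr_ge0//.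
by have := aP n Uf Yy; have := aP n Ug Yy; lra.
Qed.

(* The uniform convexity of h along each of its terms. *)
Let h_mid n f g : U f -> U g ->
  h (mid f g) + w n / 4 * (a n f - a n g) ^+ 2 <= 2^-1 * h f + 2^-1 * h g.
Proof.
move=> Uf Ug; rewrite -lerBrDr; apply: h_le => N; rewrite lerBrDr.
pose M := maxn N n.+1.
have nM : (n < M)%N by rewrite leq_max ltnSn orbT.
apply: le_trans (_ : 2^-1 * hN M f + 2^-1 * hN M g <= _); last first.
  by have := hN_le M Uf; have := hN_le M Ug; lra.
apply: le_trans (_ : hN M (mid f g) + w n / 4 * (a n f - a n g) ^+ 2 <= _).
  rewrite lerD2r /hN -(big_mkord xpredT (fun j => w j * a j (mid f g) ^+ 2)).
  rewrite -(big_mkord xpredT (fun j => w j * a j (mid f g) ^+ 2)).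
  rewrite (big_cat_nat (n := N) (p := M))//= ?leq_maxl// lerDl.
  by apply: sumr_ge0 => j _; rewrite mulr_ge0 ?sqr_ge0// ltW.
have term j : w j * a j (mid f g) ^+ 2 + w j / 4 * (a j f - a j g) ^+ 2 <=
    2^-1 * (w j * a j f ^+ 2) + 2^-1 * (w j * a j g ^+ 2).
  have : a j (mid f g) ^+ 2 <= (2^-1 * a j f + 2^-1 * a j g) ^+ 2.
    rewrite ler_sqr ?nnegrE ?a_mid// ?a_ge0//; first exact: U_mid.
    by rewrite addr_ge0// mulr_ge0 ?a_ge0// invr_ge0.
  by move=> /(ler_wpM2l (ltW (w0 j))); lra.
rewrite /hN !mulr_sumr -big_split/= (bigD1 (Ordinal nM))//=.
rewrite [leRHS](bigD1 (Ordinal nM))//= addrAC lerD//.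
apply: ler_sum => j _; apply: le_trans (term j).
by rewrite lerDl mulr_ge0 ?sqr_ge0// divr_ge0// ltW.
Qed.

Let near_max z alpha f := U f /\ q z - alpha <= val z f.

(** Otherwise, by the uniform convexity [h_mid], the midpoint of [f] and [g] would exceed the
    supremum [q z]. *)
Let a_near_max z alpha n f g : near_max z alpha f -> near_max z alpha g ->
  c * (w n / 4) * (a n f - a n g) ^+ 2 <= alpha.
Proof.
move=> [Uf fz] [Ug gz]; have := qP z (U_mid Uf Ug).
have := ler_wpM2l (ltW c0) (h_mid n Uf Ug).
by move: fz gz; rewrite /val /mid; lra.
Qed.

(** The derivative at [z] is a maximizer [f0] of [val z], obtained by weak* compactness. If [xi n]
    is close to [f0] on [Y], near-maximizers at [z + y] are almost as close to [xi n] as [f0] is,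
    hence close to [f0] on [Y]. *)
Lemma smoothing : exists q : V -> R,
  [/\ forall z, s z - kappa <= q z, forall z, q z <= s z,
      forall z u, q (z + u) <= q z + s u &
      forall z, exists f, [/\ is_linear f, forall x, f x <= s x &
        forall eps, 0 < eps -> exists2 d, 0 < d &
          forall y, Y y -> `|y| < d -> q (z + y) <= q z + f y + eps * `|y|]].
Proof.
exists q; split=> // z.
have [] := @linear_cluster R V s nat 0 (fun i => near_max z i.+1%:R^-1) ss.
- by move=> i f [].
- move=> i; have [f Uf fz] := q_near z (e := i.+1%:R^-1) ltac:(by []).
  by exists f; split=> //; exact: ltW.
- move=> i j; exists (maxn i j); split=> f [Uf fz]; split=> //;
    apply: le_trans fz; rewrite lerD2l lerN2 lef_pV2 ?posrE// ler_nat ltnS.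
    exact: leq_maxl.
  exact: leq_maxr.
move=> f0 [lf0 f0s f0cl].
have Uf0 : U f0 by [].
(* This is weak* lower semicontinuity of [h]: finitely many of the [a j f0] are almost attained at
   points [y j], and a near-maximizer [g] close to [f0] at these points cannot have much smaller
   [a j g]. *)
have f0max : q z <= val z f0.
  apply/ler_addgt0Pr => e e0.
  have K0 : 0 < 2 + 8 * c * B by have := mulr_gt0 c0 B0; lra.
  (* The factor collects [eta] for near-maximality, [eta] for the value at [z], and [8 * B * eta]
     from squaring [a j g + 2 * eta], multiplied by [c]. *)
  have [eta eta0 [etaB etae]] : exists2 eta, 0 < eta &
      eta <= B /\ eta * (2 + 8 * c * B) <= e.
    exists (Num.min B (e / (2 + 8 * c * B))); first by rewrite lt_min B0 divr_gt0.
    by split; [rewrite ge_min lexx|rewrite -ler_pdivlMr// ge_min lexx orbT].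
  have [i ieta] := exists_natSinv_lt eta0.
  suff hb : h f0 <= (f0 z - q z + e) / c.
    by rewrite ler_pdivlMr// in hb; rewrite /val; lra.
  apply: h_le => N; rewrite ler_pdivlMr//.
  have /choice[y yP] (j : nat) : exists y, Y y /\
      a j f0 - eta < `|f0 y - xi j y| / `|y|.
    by have [_ [y Yy <-] lt] := sup_adherent eta0 (a_has_sup j Uf0); exists y.
  pose u j := `|y j|^-1 *: y j.
  have [g [Ug gz] gcl] := f0cl i (z :: mkseq u N) eta eta0.
  have ag j : (j < N)%N -> a j f0 - 2 * eta <= a j g.
    move=> jN; have [Yy yf0] := yP j.
    have gu : `|g (u j) - f0 (u j)| <= eta.
      by apply: gcl; rewrite in_cons map_f ?orbT// mem_iota.
    have := a_ge0 j Ug.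
    have [y0|y0] := eqVneq (y j) 0.
      by rewrite y0 normr0 invr0 mulr0 in yf0; lra.
    have ny0 : 0 < `|y j| by rewrite normr_gt0.
    have := aP j Ug Yy; rewrite -ler_pdivrMr// => gy _.
    rewrite /u (is_linearZ _ _ Ug.1) (is_linearZ _ _ lf0) -mulrBr normrM in gu.
    rewrite normfV normr_id mulrC in gu.
    have : `|f0 (y j) - xi j (y j)| / `|y j| <=
        `|g (y j) - f0 (y j)| / `|y j| + `|g (y j) - xi j (y j)| / `|y j|.
      rewrite -mulrDl ler_pM2r ?invr_gt0//.
      by rewrite (distrC (g _) (f0 _)); exact: ler_distD.
    lra.
  have hg : hN N f0 <= hN N g + 8 * B * eta.
    apply: le_trans (_ : \sum_(j < N) (w j * a j g ^+ 2 + w j * (8 * B * eta)) <= _).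
      apply: ler_sum => j _; rewrite -mulrDr ler_pM2l//.
      have := ag j (ltn_ord j); have := a_ge0 j Ug; have := a_leB j Ug.
      have := a_ge0 j Uf0 => a1 a2 a3 a4.
      apply: le_trans (_ : (a j g + 2 * eta) ^+ 2 <= _).
        by rewrite ler_sqr ?nnegrE//; lra.
      have := ler_wpM2r (ltW eta0) a2; have := ler_wpM2r (ltW eta0) etaB.
      lra.
    rewrite big_split/= -mulr_suml lerD2l; apply: ler_piMl; last exact: sumw.
    by rewrite !mulr_ge0// ltW.
  have := gcl z (mem_head _ _) => /ler_normlP[].
  have := ler_wpM2l (ltW c0) hg; have := ler_wpM2l (ltW c0) (hN_le N Ug).
  move: gz ieta etae; rewrite /val; move: (i.+1%:R^-1) => t.
  move: (c) (hN N f0) (hN N g) (h g) => c1 h0 h1 h2. lra.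
exists f0; split=> // eps eps0.
have [n f0n] := xi_dense (eps := eps / 8) Uf0 ltac:(lra).
have af0 : a n f0 <= eps / 8 by apply: a_le => //; lra.
pose alpha := c * (w n / 4) * (eps / 8) ^+ 2.
have alpha0 : 0 < alpha.
  apply: mulr_gt0; last by apply: exprn_gt0; lra.
  by apply: mulr_gt0 => //; exact: divr_gt0.
have D0 : 0 < 2 * L + eps.
  by have := L0; lra.
(* Moving from [z + y] to [z] costs at most [2 * L + eps] times the norm of [y], so near-maximizers
   at [z + y] are [alpha]-maximizers at [z]. *)
exists (alpha / (2 * L + eps)); first by rewrite divr_gt0.
move=> y Yy; rewrite ltr_pdivlMr// => yd.
have [->|y0] := eqVneq y 0.
  by rewrite addr0 is_linear0// normr0 mulr0 !addr0.
have ny0 : 0 < `|y| by rewrite normr_gt0.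
have ey0 : 0 < eps / 2 * `|y| by rewrite mulr_gt0//; lra.
have [f Uf fzy] := q_near (z + y) ey0.
have fy : f y <= L * `|y| by exact: le_trans (Uf.2 y) (sL y).
have valE : val (z + y) f = val z f + f y.
  by rewrite /val (is_linearD _ _ Uf.1); lra.
have nf : near_max z alpha f.
  split=> //; have := q_lip (z + y) (- y); rewrite addrK.
  by have := sL (- y); rewrite normrN; lra.
have nf0 : near_max z alpha f0 by split=> //; lra.
have aff : a n f <= eps / 4.
  have := a_near_max n nf nf0; rewrite ler_pM2l; last first.
    by apply: mulr_gt0 => //; exact: divr_gt0.
  move=> h2; rewrite leNgt; apply/negP => h3.
  have h4 : eps / 8 < a n f - a n f0 by lra.
  have : (eps / 8) ^+ 2 < (a n f - a n f0) ^+ 2.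
    by rewrite ltr_sqr ?nnegrE//; lra.
  by rewrite ltNge h2.
have := qP z Uf.
have : f y - f0 y <= (a n f + a n f0) * `|y|.
  have := ler_normlW (aP n Uf Yy).
  by have := aP n Uf0 Yy => /ler_normlP[]; lra.
have : (a n f + a n f0) * `|y| <= eps * (3 / 8) * `|y|.
  by rewrite ler_pM2r//; lra.
lra.
Qed.

End smoothing.

(** * A smooth variational principle *)

Section half_powers.
Context {R : realType}.
Implicit Types n m : nat.

Lemma half_pow_gt0 n : 0 < 2^-1 ^+ n :> R.
Proof. by rewrite exprn_gt0// invr_gt0. Qed.

Lemma half_powS n : 2^-1 ^+ n.+1 = 2^-1 ^+ n / 2 :> R.
Proof. by rewrite exprS mulrC. Qed.

Lemma half_pow_le n m : (n <= m)%N -> 2^-1 ^+ m <= 2^-1 ^+ n :> R.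
Proof.
move=> /subnK <-; elim: (m - n)%N => [//|k IH].
by rewrite addSn half_powS; have := half_pow_gt0 (k + n)%N; lra.
Qed.

Lemma half_pow_le_inv n : 2^-1 ^+ n <= n.+1%:R^-1 :> R.
Proof.
rewrite exprVn lef_pV2 ?posrE ?exprn_gt0// -natrX ler_nat.
exact: ltn_expl.
Qed.

Lemma half_pow_small (K e : R) : 0 <= K -> 0 < e ->
  exists n, forall m, (n <= m)%N -> K * 2^-1 ^+ m <= e.
Proof.
move=> K0 e0; have K1 : 0 < K + 1 by lra.
have [n neps] := exists_natSinv_lt (divr_gt0 e0 K1).
exists n => m nm.
have h1 : 2^-1 ^+ m <= e / (K + 1).
  exact: le_trans (half_pow_le nm) (le_trans (half_pow_le_inv n) (ltW neps)).
rewrite ler_pdivlMr// in h1.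
by have := half_pow_gt0 m; lra.
Qed.

End half_powers.

Lemma geometric_dist {R : realType} {V : normedModType R} (u : nat -> V) (c : R) :
  (forall n, `|u n.+1 - u n| <= c * 2^-1 ^+ n.+1) ->
  forall n k, `|u n - u (k + n)%N| <= c * (2^-1 ^+ n - 2^-1 ^+ (k + n)).
Proof.
move=> uc n; elim=> [|k IH]; first by rewrite !subrr normr0 mulr0.
rewrite addSn; apply: le_trans (ler_distD (u (k + n)%N) _ _) _.
by have := uc (k + n)%N; rewrite half_powS (distrC (u _.+1)); lra.
Qed.

(** Completeness in the form that Ekeland's iteration uses, which passes to finite powers coordinate
    by coordinate. *)
Definition geometrically_complete {R : realType} (V : normedModType R) :=
  forall (u : nat -> V) (c : R),
    (forall n, `|u n.+1 - u n| <= c * 2^-1 ^+ n.+1) ->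
    exists l, forall e, 0 < e ->
      exists n, forall m, (n <= m)%N -> `|u m - l| <= e.

Definition seq_closed {R : realType} {V : normedModType R} (S : set V) :=
  forall l, (forall e, 0 < e -> exists2 z, S z & `|z - l| <= e) -> S l.

Section variational_principle.
Context {R : realType} {W : normedModType R}.
Hypothesis completeW : geometrically_complete W.

Lemma geometric_limit (u : nat -> W) (c : R) :
  (forall n, `|u n.+1 - u n| <= c * 2^-1 ^+ n.+1) ->
  exists l, forall n, `|u n - l| <= c * 2^-1 ^+ n.
Proof.
move=> uc; have [l ul] := completeW uc; exists l => n.
apply/ler_addgt0Pr => e e0; have [N Nl] := ul e e0.
have c0 : 0 <= c.
  have := le_trans (normr_ge0 _) (uc 0).
  by rewrite pmulr_lge0// half_pow_gt0.
apply: le_trans (ler_distD (u (N + n)%N) _ _) _.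
have := geometric_dist uc n N; have := Nl (N + n)%N (leq_addr _ _).
have := mulr_ge0 c0 (ltW (half_pow_gt0 (N + n)%N)). lra.
Qed.

Variables (S : set W) (x0 : W) (Q0 : W -> R) (p : nat -> W -> R).
Variables (L c rho : R).

Let cc j : R := c * 2^-1 ^+ j.+1.
Let th j : R := cc j * (rho * 2^-1 ^+ j.+1) / 4.

Hypotheses (closedS : seq_closed S) (Sx0 : S x0).
Hypotheses (L0 : 0 <= L) (c0 : 0 < c) (rho0 : 0 < rho).
Hypothesis Q0_min : forall z, S z -> Q0 x0 <= Q0 z + th 0.
Hypothesis Q0_lip : forall z u, Q0 (z + u) <= Q0 z + L * `|u|.
Hypothesis p_ge : forall j z, cc j * `|z| - th j <= p j z.
Hypothesis p_le : forall j z, p j z <= cc j * `|z|.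
Hypothesis p_lip : forall j z u, p j (z + u) <= p j z + cc j * `|u|.

Let pick (Q : W -> R) e := xget x0 [set v | S v /\ forall z, S z -> Q v <= Q z + e].

Let pickP (Q : W -> R) e b : 0 < e -> (forall z, S z -> b <= Q z) ->
  S (pick Q e) /\ forall z, S z -> Q (pick Q e) <= Q z + e.
Proof.
move=> e0 bQ.
have hQ : has_inf [set Q z | z in S].
  split; first by exists (Q x0), x0.
  by exists b => _ [z Sz <-]; exact: bQ.
have [_ [v Sv <-] ltv] := inf_adherent e0 hQ.
apply: (@xgetPex _ x0 [set v | S v /\ forall z, S z -> Q v <= Q z + e]).
exists v; split=> // z Sz; apply: le_trans (ltW ltv) _; rewrite lerD2r.
by apply: (ge_inf hQ.2); exists z.
Qed.

(** Ekeland's iteration: the function perturbed so far, paired with a near-minimizer of it; each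
    step adds a perturbation centred at the current point. *)
Let state := fix state n : (W -> R) * W :=
  if n is m.+1 then
    let: (Q, u) := state m in
    let Q' := fun z => Q z + p m (z - u) in (Q', pick Q' (th m.+1))
  else (Q0, x0).

Let u n := (state n).2.
Let Q n := (state n).1.

Let QS n z : Q n.+1 z = Q n z + p n (z - u n).
Proof. by rewrite /Q /u /=; case: (state n). Qed.

Let uS n : u n.+1 = pick (Q n.+1) (th n.+1).
Proof. by rewrite /Q /u /=; case: (state n). Qed.

Let cc_gt0 n : 0 < cc n. Proof. by rewrite mulr_gt0// half_pow_gt0. Qed.

Let th_gt0 n : 0 < th n.
Proof. by rewrite divr_gt0// mulr_gt0// mulr_gt0// half_pow_gt0. Qed.

Let Q_bounded n : exists b, forall z, S z -> b <= Q n z.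
Proof.
elim: n => [|n [b bQ]].
  by exists (Q0 x0 - th 0) => z Sz; have := Q0_min Sz; rewrite /Q/=; lra.
exists (b - th n) => z Sz; rewrite QS lerD ?bQ//.
apply: le_trans (p_ge _ _); rewrite lerDr mulr_ge0//.
exact: ltW (cc_gt0 n).
Qed.

Let uP n : S (u n) /\ forall z, S z -> Q n (u n) <= Q n z + th n.
Proof.
case: n => [|n]; first by split=> // z; exact: Q0_min.
rewrite uS; have [b bQ] := Q_bounded n.+1; exact: pickP bQ.
Qed.

Let th_le n : th n.+1 <= th n.
Proof.
rewrite /th /cc ler_pM2r; last by rewrite invr_gt0.
have h := half_pow_le (R := R) (leqnSn n.+1).
have h0 := ltW (@half_pow_gt0 R n.+2).
by apply: ler_pM; rewrite ?ler_pM2l// mulr_ge0// ltW.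
Qed.

(** Near-minimality of [u n] and [u n.+1] and the error of [p n] cost at most three tolerances
    [th n]; the divisor 4 in [th] covers them. *)
Let u_step n : `|u n.+1 - u n| <= rho * 2^-1 ^+ n.+1.
Proof.
rewrite -(ler_pM2l (cc_gt0 n)).
have := (uP n.+1).2 _ (uP n).1; have := (uP n).2 _ (uP n.+1).1.
rewrite !QS subrr; have := p_le n 0; rewrite normr0 mulr0.
have := p_ge n (u n.+1 - u n).
have := th_le n; have := th_gt0 n.
by rewrite /th -/(cc n); lra.
Qed.

Let Q_le N k z v :
  Q (k + N)%N z - Q (k + N)%N v <=
  Q N z - Q N v + c * (2^-1 ^+ N - 2^-1 ^+ (k + N)%N) * `|z - v|.
Proof.
elim: k => [|k IH]; first by rewrite !subrr mulr0 mul0r addr0.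
rewrite addSn !QS half_powS.
have := p_lip (k + N)%N (v - u (k + N)%N) (z - v).
by rewrite addrC addrA subrK /cc half_powS; lra.
Qed.

Let Q_lip N z v : Q N (z + v) <= Q N z + (L + c) * `|v|.
Proof.
have := Q_le 0 N (z + v) z; rewrite addn0 [_ - z]addrAC subrr add0r.
have := Q0_lip z v; rewrite expr0 /Q/=.
have := mulr_ge0 (mulr_ge0 (ltW c0) (ltW (half_pow_gt0 N))) (normr_ge0 v).
lra.
Qed.

(** Each truncation of the perturbation has its own inequality: the omitted tail is Lipschitz with
    constant at most [c * 2^-1 ^+ N], and this is the slope in the last term. *)
Lemma smooth_variational_principle : exists (v : nat -> W) zh,
  [/\ S zh, `|zh - x0| <= rho & forall N z, S z ->
    Q0 zh + \sum_(j < N) p j (zh - v j) <=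
    Q0 z + \sum_(j < N) p j (z - v j) + c * 2^-1 ^+ N * `|z - zh|].
Proof.
have [zh uzh] := geometric_limit u_step.
have QE N z : Q0 z + \sum_(j < N) p j (z - u j) = Q N z.
  elim: N => [|N IH]; first by rewrite big_ord0 addr0.
  by rewrite big_ord_recr/= addrA IH QS.
exists u, zh; split.
- apply: closedS => e e0.
  have [n ne] := half_pow_small (ltW rho0) e0.
  exists (u n); first exact: (uP n).1.
  exact: le_trans (uzh n) (ne n (leqnn n)).
- by have := uzh 0; rewrite expr0 mulr1 distrC.
move=> N z Sz; rewrite !QE; apply/ler_addgt0Pr => e e0.
(* Replacing [u k] by [zh] costs [L + c] in [Q N] and [c] in the slope term, times
   [rho * 2^-1 ^+ k]; the tolerance [th k] adds a last [c]. *)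
have K0 : 0 <= (L + 3 * c) * rho.
  by rewrite mulr_ge0 ?addr_ge0 ?mulr_ge0 ?(ltW c0) ?(ltW rho0).
have [n ne] := half_pow_small K0 e0.
have := ne (n + N)%N (leq_addr _ _); have := uzh (n + N)%N.
set k := (n + N)%N => ud ke.
have := (uP k).2 z Sz; have := Q_le N n z (u k); rewrite -/k.
have := Q_lip N (u k) (zh - u k); rewrite addrC subrK distrC.
have : c * (2^-1 ^+ N - 2^-1 ^+ k) * `|z - u k| <= c * 2^-1 ^+ N * `|z - u k|.
  rewrite ler_wpM2r// ler_pM2l// gerBl; exact: ltW (half_pow_gt0 k).
have h1 : c * 2^-1 ^+ N <= c.
  by rewrite ger_pMr//; have := half_pow_le (R := R) (leq0n N).
have h2 : 0 <= c * 2^-1 ^+ N := mulr_ge0 (ltW c0) (ltW (half_pow_gt0 N)).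
have := ler_wpM2l h2 (ler_distD zh z (u k)).
have := ler_wpM2r (normr_ge0 (u k - zh)) h1; rewrite (distrC zh).
have : th k <= c * rho * 2^-1 ^+ k.
  have h0 := @half_pow_gt0 R k; have h3 := half_pow_le (R := R) (leq0n k).
  have : c * rho * 2^-1 ^+ k * 2^-1 ^+ k <= c * rho * 2^-1 ^+ k.
    by rewrite ger_pMr// mulr_gt0// mulr_gt0.
  have := mulr_gt0 (mulr_gt0 c0 rho0) h0.
  by rewrite /th /cc !half_powS; lra.
have := ler_wpM2l (addr_ge0 L0 (ltW c0)) ud.
have := ler_wpM2l (ltW c0) ud.
move: (th k) (Q k) (Q N) => t Qk QN.
lra.
Qed.

End variational_principle.

(** * Separable reduction *)

Section separable_reduction.
Context {R : realType} {W : normedModType R}.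
Variables (s : W -> R) (L : R) (C : set W) (x0 : W).
Hypotheses (ss : sublinear s) (L0 : 0 <= L) (sL : forall x, s x <= L * `|x|).

Let U f := is_linear f /\ forall x, f x <= s x.

Let ok (f : W -> R) (t : seq nat) x z := forall k, (k < size t)%N ->
  `|z - x| < 2^-1 ^+ nth 0%N t k -> - (2^-1 ^+ k * `|z - x|) <= f (z - x).

Let refutes (F : seq W) t x := forall f, U f -> ~ forall z, z \in F -> ok f t x z.

Let refutes_near q (j : nat) t F := (forall z, z \in F -> C z) /\
  forall x, C x -> `|x - q| < 2^-1 ^+ j -> refutes F t x.

(* The sequence d is closed under the choice of finite families of points of C
   witnessing, uniformly on small balls, that no admissible functional satisfies
   finitely many of the estimates defining a Frechet normal. *)
Lemma separable_reduction : exists d : nat -> W,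
  [/\ (exists k, d k = x0), (forall k l, exists j, d j = d k - d l) &
   forall zh, C zh -> (forall e, 0 < e -> exists k, `|zh - d k| < e) ->
   forall r : nat -> nat,
   (forall N, exists f, [/\ is_linear f, forall x, f x <= s x &
      forall k j, (k < N)%N -> C (d j) -> `|d j - zh| < 2^-1 ^+ r k ->
        - (2^-1 ^+ k * `|d j - zh|) <= f (d j - zh)]) ->
   exists f, [/\ is_linear f, forall x, f x <= s x &
      forall k z, C z -> `|z - zh| < 2^-1 ^+ r k / 2 ->
        - (2 * 2^-1 ^+ k * `|z - zh|) <= f (z - zh)]].
Proof.
have /choice[F FP] (a : W * nat * seq nat) : exists F : seq W,
    (exists F0, refutes_near a.1.1 a.1.2 a.2 F0) ->
    refutes_near a.1.1 a.1.2 a.2 F.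
  have [[F hF]|no] := pselect (exists F0, refutes_near a.1.1 a.1.2 a.2 F0).
    by exists F.
  by exists [::].
(* [Some (j, t, i)] picks the [i]-th point of the certificate at [x], with default [x]; [None] makes
   the range of [d] stable under differences. *)
pose op (p : option (nat * seq nat * nat)) (x y : W) :=
  if p is Some (j, t, i) then nth x (F (x, j, t)) i else x - y.
have [d [dx0 dop]] := countable_hull (fun=> x0) op.
exists d; split=> [|k l|zh Czh dzh r hr].
- exact: dx0 0%N.
- exact: (dop None).
have FD k j t z : z \in F (d k, j, t) -> exists i, z = d i.
  move=> zF; have [i di] := dop (Some (j, t, index z (F (d k, j, t)))) k k.
  by exists i; rewrite di/= nth_index.
pose S (l : seq (nat * W)) := [set f | U f /\ forall k z, (k, z) \in l -> C z ->
  `|z - zh| < 2^-1 ^+ r k / 2 -> - (2 * 2^-1 ^+ k * `|z - zh|) <= f (z - zh)].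
have [] := @linear_cluster R W s (seq (nat * W)) [::] S ss.
- by move=> l f [].
- move=> l; apply: contrapT => S0.
  pose N := \max_(p <- l) (p.1).+1.
  have lN k z : (k, z) \in l -> (k < N)%N.
    by move=> kl; exact: (@leq_bigmax_seq _ l xpredT (fun p => p.1.+1) (k, z)).
  pose Fl := [seq p.2 | p <- l & `[< C p.2 >]].
  have L1 : 0 < 1 + L by have := L0; lra.
  have [|e e0 el] := @seq_min_gt0 R _ l (fun p => p.2 != zh)
      (fun p => 2^-1 ^+ p.1 * `|p.2 - zh| / (1 + L)).
    move=> p pz; apply: divr_gt0 => //; apply: mulr_gt0; first exact: half_pow_gt0.
    by rewrite normr_gt0 subr_eq0.
  have [|e' e'0 el'] := @seq_min_gt0 R _ l (fun=> True)
      (fun p => 2^-1 ^+ r p.1 / 2).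
    by move=> p _; apply: divr_gt0 => //; exact: half_pow_gt0.
  (* Halving the radii and doubling the slopes in [S] leaves room to move the centre from [zh] to a
     nearby [x]: [e'] controls the radii and [e] the slopes. *)
  have ref x : `|x - zh| <= e -> `|x - zh| <= e' -> refutes Fl (mkseq r N) x.
    move=> xe xe' f [lf fs] fok; apply: S0; exists f; split=> // k z kl Cz zd.
    have [->|zzh] := eqVneq z zh.
      by rewrite subrr normr0 mulr0 oppr0 is_linear0.
    have zF : z \in Fl.
      by apply/mapP; exists (k, z) => //; rewrite mem_filter/= asboolT.
    have kN := lN k z kl.
    have := fok z zF k; rewrite size_mkseq nth_mkseq// => /(_ kN) fz.
    have zx := ler_distD zh z x; rewrite (distrC zh) in zx.
    have := el' (k, z) kl I; rewrite /= => el'z.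
    have {}fz := fz ltac:(lra).
    have := el (k, z) kl zzh; rewrite /= => /(le_trans xe).
    rewrite ler_pdivlMr// => xL.
    have h0 := @half_pow_gt0 R k; have h1 := half_pow_le (R := R) (leq0n k).
    rewrite expr0 in h1.
    have := ler_wpM2r (normr_ge0 (x - zh)) h1; have := ler_wpM2l (ltW h0) zx.
    have := fs (zh - x); have := sL (zh - x); rewrite (distrC zh).
    move: fz; rewrite !(is_linearB _ _ lf); lra.
  have [j je] := half_pow_small (ler0n R 2) e0.
  have [j' je'] := half_pow_small (ler0n R 2) e'0.
  pose m := maxn j j'.
  have [i di] := dzh (2^-1 ^+ m) (half_pow_gt0 m).
  have Fli : refutes_near (d i) m (mkseq r N) Fl.
    split=> [z /mapP[p]|x Cx xd].
      by rewrite mem_filter => /andP[/asboolP Cp _ ->].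
    have := ler_distD (d i) x zh; rewrite (distrC (d i)) => xzh.
    apply: ref.
      by have := je m (leq_maxl _ _); lra.
    by have := je' m (leq_maxr _ _); lra.
  (* The chosen certificate also refutes at [zh], and its points occur in [d], where [hr N] provides
     a functional that meets all the estimates. *)
  have [FC /(_ zh Czh di) Fzh] := FP (d i, m, mkseq r N) (ex_intro _ Fl Fli).
  have [f [lf fs fd]] := hr N.
  apply: (Fzh f) => // z zF k; rewrite size_mkseq => kN.
  rewrite nth_mkseq// => zd; have [i' zi] := FD _ _ _ _ zF.
  by rewrite zi in zd *; apply: fd => //; rewrite -zi; exact: FC.
- move=> l1 l2; exists (l1 ++ l2).
  by split=> f [Uf fl]; split=> // k z kl; apply: fl; rewrite mem_cat kl ?orbT.
move=> f [lf fs fcl]; exists f; split=> // k z Cz zd.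
apply/ler_addgt0Pr => e e0.
have [g [_ gl] gf] := fcl [:: (k, z)] [:: z - zh] e e0.
have := gl k z (mem_head _ _) Cz zd.
by have /ler_normlP[] := gf (z - zh) (mem_head _ _); lra.
Qed.

End separable_reduction.

(** * The fuzzy rule *)

Section fuzzy_rule.
Context {R : realType} {W : normedModType R}.

(** Minorants of [s] become contractive after division by [L], so the family [L * xi n] is dense
    among them and [B = 2 * L] bounds the distances. *)
Lemma smoothing_separable (Y : set W) (xi : nat -> W -> R) (s : W -> R)
    (L kappa : R) :
  Y 0 -> (forall n, contractive (xi n)) ->
  (forall f, contractive f -> forall eps, 0 < eps ->
     exists n, forall y, Y y -> `|f y - xi n y| <= eps * `|y|) ->
  sublinear s -> 0 < L -> (forall x, s x <= L * `|x|) -> 0 < kappa ->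
  exists q : W -> R,
  [/\ forall z, s z - kappa <= q z, forall z, q z <= s z,
      forall z u, q (z + u) <= q z + s u &
      forall z, exists f, [/\ is_linear f, forall x, f x <= s x &
        forall eps, 0 < eps -> exists2 d, 0 < d &
          forall y, Y y -> `|y| < d -> q (z + y) <= q z + f y + eps * `|y|]].
Proof.
move=> Y0 cxi xid ss L0 sL kappa0.
have Uc f : is_linear f -> (forall x, f x <= s x) ->
    contractive (fun x => L^-1 * f x).
  move=> lf fs; split=> [|x]; first exact: is_linear_scale.
  by rewrite ler_pdivrMl//; exact: le_trans (fs x) (sL x).
have scale f n y : L^-1 * f y - xi n y = L^-1 * (f y - L * xi n y).
  by rewrite mulrBr mulKf ?gt_eqF.
apply: (smoothing (L := L) (xi := fun n y => L * xi n y) (B := 2 * L)) => //.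
- exact: ltW.
- by rewrite mulr_gt0.
- move=> f n y [lf fs] _; have cf := Uc f lf fs.
  have := contractive_norm y cf; have := contractive_norm y (cxi n) => h1 h2.
  have := ler_normB (L^-1 * f y) (xi n y).
  rewrite scale normrM gtr0_norm ?invr_gt0// ler_pdivrMl// => h.
  apply: le_trans h _; rewrite -mulrA mulrCA ler_pM2l//; lra.
- move=> f eps [lf fs] eps0; have cf := Uc f lf fs.
  have [n fn] := xid _ cf (eps / L) (divr_gt0 eps0 L0).
  exists n => y Yy; have := fn y Yy.
  rewrite scale normrM gtr0_norm ?invr_gt0// ler_pdivrMl//.
  by rewrite mulrA [L * (_ / _)]mulrC divfK ?gt_eqF.
Qed.

Hypotheses (completeW : geometrically_complete W)
  (sepW : separable_dual_restrictions W).

Lemma fuzzy_normal (C : set W) (x0 : W) (s : W -> R) (L eps : R) :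
  seq_closed C -> C x0 -> sublinear s -> 0 < L -> (forall x, s x <= L * `|x|) ->
  (forall z, C z -> 0 <= s (z - x0)) -> 0 < eps ->
  exists zh f, [/\ C zh, `|zh - x0| <= eps, is_linear f,
    forall x, f x <= s x + eps * `|x| &
    forall e, 0 < e -> exists2 d, 0 < d & forall z, C z -> `|z - zh| < d ->
      - (e * `|z - zh|) <= f (z - zh)].
Proof.
move=> clC Cx0 ss L0 sL C_ge0 eps0.
have s'sub : sublinear (fun x => s x + eps * `|x|).
  have [sD sZ] := ss; have [nD nZ] := sublinear_norm (V := W) (ltW eps0).
  split=> [x y|t x t0]; first by have := sD x y; have := nD x y; lra.
  by have := sZ t x t0; have := nZ t x t0; lra.
have s'L x : s x + eps * `|x| <= (L + eps) * `|x|.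
  by have := sL x; lra.
have Le0 : 0 <= L + eps by lra.
have [d [[k0 dk0] dB red]] := separable_reduction C x0 s'sub Le0 s'L.
pose Y := [set y | forall e, 0 < e -> exists k, `|y - d k| < e].
have YB x y : Y x -> Y y -> Y (x - y).
  move=> Yx Yy e e0; have e2 : 0 < e / 2 by lra.
  have [[k xk] [l yl]] := (Yx _ e2, Yy _ e2).
  have [j dj] := dB k l; exists j; rewrite dj opprD addrACA -opprD.
  by apply: le_lt_trans (ler_normB _ _) _; lra.
have Yx0 : Y x0 by move=> e e0; exists k0; rewrite dk0 subrr normr0.
have Y0 : Y 0 by rewrite -(subrr x0); exact: YB.
have Yd k : Y (d k) by move=> e e0; exists k; rewrite subrr normr0.
have [xi [cxi xid]] := sepW d.
have xiY f : contractive f -> forall e, 0 < e ->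
    exists n, forall y, Y y -> `|f y - xi n y| <= e * `|y|.
  move=> cf e e0; have [n fn] := xid f cf e e0.
  exists n => y Yy; apply/ler_addgt0Pr => h h0.
  have K0 : 0 < 2 + e by lra.
  have [k yk] := Yy (h / (2 + e)) (divr_gt0 h0 K0).
  rewrite ltr_pdivlMr// in yk.
  have -> : f y - xi n y = (f (d k) - xi n (d k)) + f (y - d k) - xi n (y - d k).
    by rewrite (is_linearB _ _ cf.1) (is_linearB _ _ (cxi n).1); lra.
  apply: le_trans (ler_normB _ _) _.
  apply: le_trans (lerD (ler_normD _ _) (contractive_norm _ (cxi n))) _.
  have := fn k; have := contractive_norm (y - d k) cf.
  have := ler_wpM2l (ltW e0) (ler_normD (d k - y) y).
  by rewrite subrK (distrC (d k)); lra.
(* The bound [eps] keeps all the perturbations together within [eps] times the norm; the bound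
   [8^-1] makes the tails negligible against the slopes [2^-1 ^+ k]. *)
pose c := Num.min eps 8^-1.
have c0 : 0 < c by rewrite lt_min eps0/= invr_gt0 ltr0n.
have ceps : c <= eps by rewrite ge_min lexx.
have c8 : c <= 8^-1 by rewrite ge_min lexx orbT.
pose cc j := c * 2^-1 ^+ j.+1.
pose th j := cc j * (eps * 2^-1 ^+ j.+1) / 4.
have cc0 j : 0 < cc j by exact: mulr_gt0 c0 (half_pow_gt0 _).
have th0 j : 0 < th j.
  apply: divr_gt0 => //; apply: mulr_gt0 => //.
  exact: mulr_gt0 eps0 (half_pow_gt0 _).
(* With smoothing error [th 0], the point [x0] minimizes [q (z - x0)] over [C] up to exactly the
   tolerance at which the iteration starts. *)
have [q [q_ge q_le q_lip q_diff]] :=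
  smoothing_separable Y0 cxi xiY ss L0 sL (th0 0%N).
have /choice[p pP] (j : nat) := smoothing_separable Y0 cxi xiY
  (sublinear_norm (ltW (cc0 j))) (cc0 j) (fun x => lexx (cc j * `|x|)) (th0 j).
have clS : seq_closed (C `&` Y).
  move=> l lS; split.
    by apply: clC => e /lS[z [Cz _]]; exists z.
  move=> e e0; have e2 : 0 < e / 2 by lra.
  have [z [_ Yz] zl] := lS _ e2; have [k zk] := Yz _ e2.
  exists k; apply: le_lt_trans (ler_distD z _ _) _.
  by rewrite (distrC l); lra.
have [|||||v [zh [[Czh Yzh] zhx0 zh_min]]] := @smooth_variational_principle R W
    completeW (C `&` Y) x0 (fun z => q (z - x0)) p L c eps clS (conj Cx0 Yx0)
    (ltW L0) c0 eps0.
- move=> z [Cz Yz]; rewrite subrr; have := q_le 0; rewrite (sublinear0 ss).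
  by have := q_ge (z - x0); have := C_ge0 z Cz; rewrite /th /cc; lra.
- move=> z u; rewrite addrAC; apply: le_trans (q_lip _ _) _.
  by rewrite lerD2l.
- by move=> j z; have [pg _ _ _] := pP j; exact: pg.
- by move=> j z; have [_ pl _ _] := pP j; exact: pl.
- by move=> j z u; have [_ _ pl _] := pP j; exact: pl.
have [fq [lfq fqs fqd]] := q_diff (zh - x0).
have /choice[fp fpP] (j : nat) : exists f, [/\ is_linear f,
    forall x, f x <= cc j * `|x| & forall e, 0 < e -> exists2 d, 0 < d &
      forall y, Y y -> `|y| < d ->
        p j (zh - v j + y) <= p j (zh - v j) + f y + e * `|y|].
  by have [_ _ _ pd] := pP j; exact: pd.
pose phi N x := fq x + \sum_(j < N) fp j x.
pose Q N z := q (z - x0) + \sum_(j < N) p j (z - v j).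
have lphi N : is_linear (phi N).
  elim: N => [|N IH] a x y; rewrite /phi.
    by rewrite !big_ord0 !addr0 lfq.
  rewrite !big_ord_recr/= !addrA; have := IH a x y; rewrite /phi => ->.
  by have [-> _ _] := fpP N; lra.
have phi_tail N k x :
    phi N x - c * (2^-1 ^+ N - 2^-1 ^+ (k + N)) * `|x| <= phi (k + N)%N x.
  elim: k => [|k IH]; first by rewrite subrr mulr0 mul0r subr0.
  rewrite addSn {2}/phi big_ord_recr/= addrA -/(phi _ x).
  have [lf fc _] := fpP (k + N)%N.
  have := fc (- x); rewrite is_linearN// normrN /cc half_powS.
  lra.
have phi_le N x : phi N x <= s x + eps * `|x|.
  have : phi N x <= s x + c * (1 - 2^-1 ^+ N) * `|x|.
    elim: N => [|N IH].
      by rewrite /phi big_ord0 expr0 subrr mulr0 mul0r !addr0.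
    rewrite /phi big_ord_recr/= addrA -/(phi _ x) half_powS.
    have [_ /(_ x) + _] := fpP N; rewrite /cc half_powS; lra.
  have := ler_wpM2r (normr_ge0 x) ceps.
  have := mulr_ge0 (mulr_ge0 (ltW c0) (ltW (half_pow_gt0 N))) (normr_ge0 x).
  lra.
have Qdiff N e : 0 < e -> exists2 d, 0 < d & forall y, Y y -> `|y| < d ->
    Q N (zh + y) <= Q N zh + phi N y + e * `|y|.
  elim: N e => [|N IH] e e0.
    have [d1 d10 d1P] := fqd e e0; exists d1 => // y Yy yd.
    by rewrite /Q /phi !big_ord0 !addr0 addrAC; exact: d1P.
  have [d1 d10 d1P] := IH (e / 2) ltac:(lra).
  have [_ _ /(_ (e / 2) ltac:(lra))[d2 d20 d2P]] := fpP N.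
  exists (Num.min d1 d2); first by rewrite lt_min d10.
  move=> y Yy; rewrite lt_min => /andP[yd1 yd2].
  have := d1P y Yy yd1; have := d2P y Yy yd2.
  by rewrite /Q /phi !big_ord_recr/= (addrAC zh y (- v N)); lra.
(* The slope [2^-1 ^+ k] is tested on the truncation [phi k]; passing to a longer [phi N] later
   costs at most a further [c * 2^-1 ^+ k]. *)
have /choice[r rP] (k : nat) : exists r : nat, forall z, C z -> Y z ->
    `|z - zh| < 2^-1 ^+ r ->
    - (2^-1 * 2^-1 ^+ k * `|z - zh|) <= phi k (z - zh).
  have h0 := @half_pow_gt0 R k.
  have [d1 d10 d1P] := Qdiff k (4^-1 * 2^-1 ^+ k) ltac:(by rewrite mulr_gt0).
  have [r rd] := half_pow_small (ler01 : 0 <= 1 :> R) d10.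
  exists r => z Cz Yz zr; have := rd r (leqnn r); rewrite mul1r => rd1.
  have := d1P (z - zh) (YB _ _ Yz Yzh) (lt_le_trans zr rd1).
  have := zh_min k z (conj Cz Yz); rewrite -/(Q k zh) -/(Q k z) (addrC zh (z - zh)) subrK.
  have := ler_wpM2r (mulr_ge0 (ltW h0) (normr_ge0 (z - zh))) c8.
  have := mulr_ge0 (ltW h0) (normr_ge0 (z - zh)).
  lra.
have [N|f [lf fs fC]] := red zh Czh Yzh r.
  exists (phi N); split=> // k j kN Cdj djr.
  have := rP k (d j) Cdj (Yd j) djr.
  have := phi_tail k (N - k)%N (d j - zh); rewrite subnK ?(ltnW kN)//.
  have := ler_wpM2r (mulr_ge0 (ltW (half_pow_gt0 k)) (normr_ge0 (d j - zh))) c8.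
  have := mulr_ge0 (mulr_ge0 (ltW c0) (ltW (half_pow_gt0 N)))
    (normr_ge0 (d j - zh)).
  have := mulr_ge0 (ltW (half_pow_gt0 k)) (normr_ge0 (d j - zh)).
  lra.
exists zh, f; split=> // e e0.
have [k ke] := half_pow_small (ler0n R 2) e0.
exists (2^-1 ^+ r k / 2); first by apply: divr_gt0 => //; exact: half_pow_gt0.
move=> z Cz zd; apply: le_trans (fC k z Cz zd).
by rewrite lerN2 ler_wpM2r// ke.
Qed.

End fuzzy_rule.

(** * Finite powers of a normed module *)

Lemma complete_geometrically_complete {R : realType}
  (X : completeNormedModType R) : geometrically_complete X.
Proof.
move=> u c uc.
have c0 : 0 <= c.
  by have := le_trans (normr_ge0 _) (uc 0); rewrite pmulr_lge0// half_pow_gt0.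
have dist n m : (n <= m)%N -> `|u n - u m| <= c * 2^-1 ^+ n.
  move=> /subnK <-; apply: le_trans (geometric_dist uc n _) _.
  by rewrite ler_wpM2l// gerBl ltW// half_pow_gt0.
have : cvgn u.
  apply: cauchy_cvg; apply/cauchy_ballP => e e0.
  have [n ne] := half_pow_small c0 (ltac:(lra) : 0 < e / 3).
  exists ([set u m | m in [set m | (n <= m)%N]], [set u m | m in [set m | (n <= m)%N]]).
    by split; exists n => // m /= nm; exists m.
  move=> [_ _] [/= [m1 /= nm1 <-] [m2 /= nm2 <-]].
  rewrite -ball_normE/=; apply: le_lt_trans (ler_distD (u n) _ _) _.
  have := dist n m1 nm1; have := dist n m2 nm2; have := ne n (leqnn n).
  by rewrite (distrC (u m1)); lra.
move=> /cvg_ex[l ul]; exists l => e e0.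
have /cvgrPdist_le/(_ e e0)[n _ ne] := ul.
by exists n => m nm; rewrite distrC; exact: ne.
Qed.

(** A name of its own for the finite functions, to carry the sum norm, for which a functional is
    contractive as soon as its components are. *)
Definition fpow {R : realType} (I : finType) (X : normedModType R) : Type :=
  {ffun I -> X}.

Section fpow.
Context {R : realType} {I : finType} {X : normedModType R}.

HB.instance Definition _ := GRing.Lmodule.on (fpow I X).

Implicit Types (v w : fpow I X) (i : I) (x : X).

Definition fpow_coord w i : X := (w : {ffun I -> X}) i.

Definition fpow_norm w : R := \sum_i `|fpow_coord w i|.

Lemma fpow_coordD v w i :
  fpow_coord (v + w) i = fpow_coord v i + fpow_coord w i.
Proof. exact: ffunE. Qed.

Lemma fpow_coordZ a v i : fpow_coord (a *: v) i = a *: fpow_coord v i.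
Proof. exact: ffunE. Qed.

Lemma fpow_normD v w : fpow_norm (v + w) <= fpow_norm v + fpow_norm w.
Proof.
by rewrite -big_split; apply: ler_sum => i _; rewrite fpow_coordD ler_normD.
Qed.

Lemma fpow_normZ (a : R) w : fpow_norm (a *: w) = `|a| * fpow_norm w.
Proof.
by rewrite mulr_sumr; apply: eq_bigr => i _; rewrite fpow_coordZ normrZ.
Qed.

Lemma fpow_norm_eq0 w : fpow_norm w = 0 -> w = 0.
Proof.
move=> /psumr_eq0P => w0; apply/ffunP => i.
have /normr0_eq0 := w0 (fun i _ => normr_ge0 (fpow_coord w i)) i isT.
by rewrite /fpow_coord => ->; rewrite ffunE.
Qed.

HB.instance Definition _ :=
  Lmodule_isNormed.Build R (fpow I X) fpow_normD fpow_normZ fpow_norm_eq0.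

Lemma fpow_normE w : `|w| = \sum_i `|fpow_coord w i|.
Proof. by []. Qed.

Lemma fpow_coordB v w i :
  fpow_coord (v - w) i = fpow_coord v i - fpow_coord w i.
Proof. by rewrite fpow_coordD -scaleN1r fpow_coordZ scaleN1r. Qed.

Lemma fpow_coord_le w i : `|fpow_coord w i| <= `|w|.
Proof. by rewrite fpow_normE (bigD1 i)//= lerDl sumr_ge0. Qed.

Definition fpow_single i x : fpow I X := [ffun j => if j == i then x else 0].

Definition fpow_const x : fpow I X := [ffun=> x].

Lemma fpow_singleE i x j :
  fpow_coord (fpow_single i x) j = if j == i then x else 0.
Proof. exact: ffunE. Qed.

Lemma fpow_constE x j : fpow_coord (fpow_const x) j = x.
Proof. exact: ffunE. Qed.

Lemma fpow_norm_single i x : `|fpow_single i x| = `|x|.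
Proof.
rewrite fpow_normE (bigD1 i)//= fpow_singleE eqxx big1 ?addr0// => j /negPf ji.
by rewrite fpow_singleE ji normr0.
Qed.

Lemma fpow_norm_const x : `|fpow_const x| = #|I|%:R * `|x|.
Proof.
rewrite fpow_normE (eq_bigr (fun=> `|x|)) => [|i _]; last by rewrite fpow_constE.
by rewrite sumr_const mulr_natl.
Qed.

Lemma fpow_single_linear i a x y :
  fpow_single i (a *: x + y) = a *: fpow_single i x + fpow_single i y.
Proof.
apply/ffunP => j; rewrite !ffunE; case: eqP => // _.
by rewrite scaler0 addr0.
Qed.

Lemma fpow_coord_sum (J : Type) (l : seq J) (P : pred J) (F : J -> fpow I X) i :
  fpow_coord (\sum_(j <- l | P j) F j) i = \sum_(j <- l | P j) fpow_coord (F j) i.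
Proof.
by apply: (big_morph (fpow_coord^~ i)) => [v w|]; [exact: fpow_coordD|exact: ffunE].
Qed.

Lemma fpow_eq v w : (forall i, fpow_coord v i = fpow_coord w i) -> v = w.
Proof. by move=> vw; apply/ffunP. Qed.

Lemma fpow_sum_single w : w = \sum_i fpow_single i (fpow_coord w i).
Proof.
apply: fpow_eq => j; rewrite fpow_coord_sum (bigD1 j)//= fpow_singleE eqxx.
rewrite big1 ?addr0// => i ij; rewrite fpow_singleE.
by rewrite eq_sym (negPf ij).
Qed.

Lemma is_linear_single (f : fpow I X -> R) i : is_linear f ->
  is_linear (fun x => f (fpow_single i x)).
Proof. by move=> lf a x y; rewrite fpow_single_linear lf. Qed.

Lemma fpow_geometrically_complete :
  geometrically_complete X -> geometrically_complete (fpow I X).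
Proof.
move=> cX u c uc.
have /choice[l lP] i : exists l, forall e, 0 < e -> exists n, forall m,
    (n <= m)%N -> `|fpow_coord (u m) i - l| <= e.
  apply: (cX _ c) => n; rewrite -fpow_coordB.
  exact: le_trans (fpow_coord_le _ _) (uc n).
exists ([ffun i => l i] : fpow I X) => e e0.
have I0 : 0 < #|I|.+1%:R :> R by [].
have /choice[n nP] i := lP i _ (divr_gt0 e0 I0).
exists (\max_i n i) => m nm; rewrite fpow_normE.
apply: le_trans (_ : \sum_(i : I) e / #|I|.+1%:R <= _).
  apply: ler_sum => i _; rewrite fpow_coordB [fpow_coord (finfun _) i]ffunE.
  by apply: nP; apply: leq_trans nm; exact: leq_bigmax.
rewrite sumr_const -[leLHS]mulr_natl mulrA ler_pdivrMr// mulrC ler_pM2l//.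
by rewrite ler_nat.
Qed.

(** One family [xi] serves all coordinates of all [e k], enumerated together; finite tuples of
    indices are countable, and with the sum norm the errors add up. *)
Lemma fpow_separable_dual_restrictions :
  separable_dual_restrictions X -> separable_dual_restrictions (fpow I X).
Proof.
move=> sX e.
pose e' n := if unpickle n is Some (k, i) then fpow_coord (e k) i else 0.
have [xi [cxi xid]] := sX e'.
pose Xi (t : {ffun I -> nat}) (w : fpow I X) := \sum_i xi (t i) (fpow_coord w i).
have cXi t : contractive (Xi t).
  split=> [a v w|w]; last first.
    by rewrite fpow_normE; apply: ler_sum => i _; have [_ ->] := cxi (t i).
  rewrite /Xi mulr_sumr -big_split; apply: eq_bigr => i _.
  by rewrite fpow_coordD fpow_coordZ; have [-> _] := cxi (t i).
exists (fun n => if unpickle n is Some t then Xi t else fun=> 0); split.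
  by move=> n; case: unpickle => [t|]; [exact: cXi|exact: contractive0].
move=> f [lf f1] eps eps0.
have cf i : contractive (fun x => f (fpow_single i x)).
  by split=> [|x]; [exact: is_linear_single|rewrite -(fpow_norm_single i)].
have /choice[n nP] i := xid _ (cf i) eps eps0.
exists (pickle [ffun i => n i]) => k; rewrite pickleK.
rewrite {1}(fpow_sum_single (e k)) is_linear_sum// /Xi -sumrB.
apply: le_trans (ler_norm_sum _ _ _) _; rewrite fpow_normE mulr_sumr.
apply: ler_sum => i _; rewrite ffunE.
by have := nP i (pickle (k, i)); rewrite /e' pickleK.
Qed.

End fpow.

(** * Frechet normals and the penalty *)

Section dual_facts.
Context {R : realType} {X : normedModType R}.

Lemma dual_is_linear (f : dual X) : is_linear (f : X -> R).
Proof. exact: dual_linear. Qed.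

Lemma dual_apply_le (f : dual X) x : `|f x| <= `|f| * `|x|.
Proof.
have [->|x0] := eqVneq x 0.
  by rewrite (is_linear0 (dual_is_linear f)) !normr0 mulr0.
have nx0 : 0 < `|x| by rewrite normr_gt0.
have := dual_norm_ub f (x := `|x|^-1 *: x).
rewrite (is_linearZ _ _ (dual_is_linear f)) normrZ normrM normfV normr_id.
by rewrite mulVf ?gt_eqF// => /(_ (lexx _)); rewrite ler_pdivrMl// mulrC.
Qed.

Lemma dual_of_bounded (g : X -> R) c : is_linear g -> 0 <= c ->
  (forall x, g x <= c * `|x|) ->
  exists2 f : dual X, (forall x, f x = g x) & `|f| <= c.
Proof.
move=> lg c0 gc.
have gc' x : `|g x| <= c * `|x|.
  by rewrite ler_norml gc andbT lerNl -is_linearN// -[`|x|]normrN.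
have dg : (g : X -> R^o) \in is_dual.
  rewrite inE; split=> [//|x]; apply/cvgrPdist_le => e e0.
  have c1 : 0 < c + 1 by lra.
  near=> y; have xy : `|x - y| <= e / (c + 1).
    by near: y; apply: cvgr_dist_le; [exact: cvg_id|exact: divr_gt0].
  rewrite ler_pdivlMr// in xy; rewrite -is_linearB//.
  apply: le_trans (gc' _) _.
  by have := normr_ge0 (x - y); lra.
exists (Dual dg) => //; apply: dual_norm_le => x x1.
by apply: le_trans (gc' x) _; rewrite -[leRHS]mulr1 ler_wpM2l.
Unshelve. all: by end_near. Qed.

Lemma frechet_normal_coneP (A : set X) (x : X) (f : dual X) :
  frechet_normal_cone A x f <->
  forall e, 0 < e -> exists2 d, 0 < d & forall y, A y -> `|y - x| < d ->
    f (y - x) <= e * `|y - x|.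
Proof.
split=> [fN e e0|fN].
  have : (limf_esup (fun y => (f (y - x) / `|y - x|)%:E) (within A x^') < e%:E)%E.
    by apply: le_lt_trans fN _; rewrite lte_fin.
  move=> /ereal_inf_lt[_ [V VF <-] supV].
  have /nbhs_ballP[d /= d0 dV] := VF.
  exists d => // y Ay yd; have [->|yx] := eqVneq y x.
    by rewrite subrr normr0 mulr0 (is_linear0 (dual_is_linear f)).
  rewrite -ler_pdivrMr ?normr_gt0 ?subr_eq0// -lee_fin.
  apply: le_trans (ltW supV); apply: ereal_sup_ubound; exists y => //.
  by apply: dV => //; rewrite -ball_normE/= distrC.
apply/lee_addgt0Pr => e e0; rewrite add0e.
have [d d0 dP] := fN e e0.
apply: (@le_trans _ _ (ereal_sup ((fun y => (f (y - x) / `|y - x|)%:E) @`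
    [set y | [/\ A y, y != x & `|y - x| < d]]))).
  apply: ereal_inf_lbound; exists [set y | [/\ A y, y != x & `|y - x| < d]] => //.
  apply/nbhs_ballP; exists d => //= y; rewrite -ball_normE/= distrC => yd yx Ay.
  by split.
apply: ge_ereal_sup => _ [y [Ay yx yd] <-].
by rewrite lee_fin ler_pdivrMr ?normr_gt0 ?subr_eq0// dP.
Qed.

Lemma closed_seq_closed (A : set X) : closed A -> seq_closed A.
Proof.
move=> cA l lA; apply: cA => B /nbhs_ballP[e /= e0 eB].
have e2 : 0 < e / 2 by lra.
have [z Az zl] := lA _ e2; exists z; split=> //; apply: eB.
by rewrite -ball_normE/= distrC; lra.
Qed.

Lemma dist_le (A : set X) x a : A a -> dist x A <= `|x - a|.
Proof.
move=> Aa; apply: ge_inf; last by exists a.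
by exists 0 => _ [y _ <-].
Qed.

Lemma dist_near (A : set X) x e : A !=set0 -> 0 < e ->
  exists2 a, A a & `|x - a| < dist x A + e.
Proof.
move=> [a0 Aa0] e0.
have hA : has_inf [set `|x - y| | y in A].
  by split; [exists `|x - a0|, a0|exists 0 => _ [y _ <-]].
by have [_ [a Aa <-] lt] := inf_adherent e0 hA; exists a.
Qed.

End dual_facts.

Section penalty.
Context {R : realType} {X : normedModType R}.

(* The penalized functional whose linear minorants encode, at the same time, the
   decomposition of f and the bounds on its components; the coordinate None is
   the free point and the coordinates Some i belong to the sets. *)
Definition penalty (m : nat) (f : X -> R) (eta tau : R)
    (w : fpow (option 'I_m) X) : R :=
  - f (fpow_coord w None) + eta * `|fpow_coord w None| +
  tau * \sum_(i < m) `|fpow_coord w None - fpow_coord w (Some i)|.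

Lemma penalty_sublinear m f eta tau : is_linear f -> 0 <= eta -> 0 <= tau ->
  sublinear (@penalty m f eta tau).
Proof.
move=> lf eta0 tau0; split=> [v w|t w t0]; rewrite /penalty.
  rewrite fpow_coordD (is_linearD _ _ lf).
  have := ler_wpM2l eta0 (ler_normD (fpow_coord v None) (fpow_coord w None)).
  have : \sum_(i < m) `|fpow_coord v None + fpow_coord w None -
        fpow_coord (v + w) (Some i)| <=
      \sum_(i < m) `|fpow_coord v None - fpow_coord v (Some i)| +
      \sum_(i < m) `|fpow_coord w None - fpow_coord w (Some i)|.
    rewrite -big_split; apply: ler_sum => i _.
    by rewrite fpow_coordD opprD addrACA ler_normD.
  by move=> /(ler_wpM2l tau0); lra.
rewrite fpow_coordZ (is_linearZ _ _ lf) normrZ (gtr0_norm t0).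
rewrite (eq_bigr (fun i : 'I_m =>
  t * `|fpow_coord w None - fpow_coord w (Some i)|)) => [|i _].
  by rewrite -mulr_sumr; lra.
by rewrite fpow_coordZ -scalerBr normrZ gtr0_norm.
Qed.

Lemma penalty_le m f eta tau c : 0 <= eta -> 0 <= tau -> 0 <= c ->
  (forall x, - f x <= c * `|x|) ->
  forall w, @penalty m f eta tau w <= (c + eta + tau * (m%:R * 2)) * `|w|.
Proof.
move=> eta0 tau0 c0 fc w; rewrite /penalty.
have := fc (fpow_coord w None); have h := fpow_coord_le w None.
have := ler_wpM2l c0 h; have := ler_wpM2l eta0 h.
have : \sum_(i < m) `|fpow_coord w None - fpow_coord w (Some i)| <=
    m%:R * (2 * `|w|).
  rewrite -[m in m%:R]card_ord mulr_natl -sumr_const; apply: ler_sum => i _.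
  apply: le_trans (ler_normB _ _) _.
  by have := fpow_coord_le w (Some i); lra.
by move=> /(ler_wpM2l tau0); lra.
Qed.

End penalty.

Section normal_estimate.
Context {R : realType} {X : normedModType R}.

(** Test the normal at an almost nearest point [a] of [A] to [y]. As [a] is within three times the
    distance from [y] to [x], the errors are [3 * e2] and [e2], whence [e / 4] and the radius
    [d / 3]. *)
Lemma frechet_normal_le_dist (A : set X) (x : X) (f : dual X) e :
  A x -> frechet_normal_cone A x f -> `|f| <= 1 -> 0 < e ->
  exists2 d, 0 < d & forall y, `|y - x| < d ->
    f (y - x) <= e * `|y - x| + dist y A.
Proof.
move=> Ax /frechet_normal_coneP fN f1 e0.
pose e2 := Num.min (e / 4) 1.
have e20 : 0 < e2 by rewrite lt_min ltr01 andbT; lra.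
have e2e : e2 <= e / 4 by rewrite ge_min lexx.
have e21 : e2 <= 1 by rewrite ge_min lexx orbT.
have [d d0 dP] := fN e2 e20.
exists (d / 3) => [|y yd]; first by lra.
have lf := dual_is_linear f.
have [->|yx] := eqVneq y x.
  rewrite subrr is_linear0// normr0 mulr0 add0r.
  by apply: lb_le_inf => [|_ [a _ <-]//]; exists `|x - x|, x.
have ny0 : 0 < `|y - x| by rewrite normr_gt0 subr_eq0.
have [a Aa ya] := dist_near y (ex_intro _ x Ax) (mulr_gt0 e20 ny0).
have dyx := dist_le y Ax.
have ax : `|a - x| <= 3 * `|y - x|.
  have := ler_distD y a x; rewrite (distrC a y) => h.
  by have := ler_wpM2r (ltW ny0) e21; lra.
have := dP a Aa ltac:(lra).
have -> : f (y - x) = f (a - x) + f (y - a).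
  by rewrite !(is_linearB _ _ lf); lra.
have := ler_normlW (dual_apply_le f (y - a)).
have := ler_wpM2r (normr_ge0 (y - a)) f1.
have := ler_wpM2l (ltW e20) ax.
have := ler_wpM2r (ltW ny0) e2e.
lra.
Qed.

End normal_estimate.

(** * The theorem *)

Theorem theorem3p1 (R : realType) (X : completeNormedModType R)
    (asplundX : asplund X) (m : nat) (m_gt0 : (0 < m)%N) (A : 'I_m -> set X)
    (closedA : forall i, closed (A i)) (A_neq0 : \bigcap_i A i !=set0)
    (xbar : X) (Axbar : (\bigcap_i A i) xbar)
    (subtrA : subtransversal A xbar) :
  exists tau delta : R, [/\ 0 < tau, 0 < delta &
    forall eps : R, 0 < eps ->
    forall x : X, (ball xbar delta `&` \bigcap_i A i) x ->
      frechet_normal_cone (\bigcap_i A i) x `&` closed_unit_ball (dual X)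
      `<=`
      set_add
        (\bigcup_(xs in [set xs : 'I_m -> X |
                          forall i, (A i `&` ball x eps) (xs i)])
          set_scale tau
            (set_sum (fun i => frechet_normal_cone (A i) (xs i) `&`
               set_scale (1 + eps) (closed_unit_ball (dual X)))))
        (set_scale eps (closed_unit_ball (dual X)))].
Proof.
have [tau [r [tau0 r0 subA]]] := subtrA.
exists tau, (r / 2); split=> //; first by lra.
move=> eps eps0 x [xr Ax] f [fN f1].
have lf := dual_is_linear f.
pose eta := eps / 2.
have eta0 : 0 < eta by rewrite /eta; lra.
have [d d0 dP] := frechet_normal_le_dist Ax fN f1 eta0.
pose rho := Num.min (d / 2) (r / 2).
have rho0 : 0 < rho by rewrite lt_min; apply/andP; split; lra.
have rhod : rho <= d / 2 by rewrite ge_min lexx.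
have rhor : rho <= r / 2 by rewrite ge_min lexx orbT.
pose K : R := #|{: option 'I_m}|%:R.
have K0 : 0 <= K by [].
(* The four bounds serve, in order, the norms of the normals, keeping [zh] well inside the ball in
   [C], the distances from the [x_i] to [x], and the final error on the diagonal, whose vectors have
   norm [K] times that of [u]. *)
have [e' e'0 [e'tau e'rho e'eps e'K]] : exists2 e', 0 < e' &
    [/\ e' <= tau * eps, e' <= rho / 2, e' <= eps / 2 & e' * K <= eps / 2].
  have K1 : 0 < K + 1 by lra.
  exists (Num.min (Num.min (tau * eps) (rho / 2)) (eps / 2 / (K + 1))).
    by rewrite !lt_min mulr_gt0// !divr_gt0.
  set e' := Num.min _ _.
  have : e' <= eps / 2 / (K + 1) by rewrite ge_min lexx orbT.
  have e'0 : 0 < e' by rewrite !lt_min mulr_gt0// !divr_gt0.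
  have le1 : e' <= tau * eps by rewrite !ge_min lexx.
  have le2 : e' <= rho / 2 by rewrite !ge_min lexx orbT.
  clearbody e'; rewrite ler_pdivlMr// => e'K.
  by have e'K0 := mulr_ge0 (ltW e'0) K0; split=> //; lra.
pose C := [set w : fpow (option 'I_m) X |
  (forall i, A i (fpow_coord w (Some i))) /\ `|w - fpow_const x| <= rho].
have clC : seq_closed C.
  move=> l lC; split=> [i|].
    apply: (closed_seq_closed (closedA i)) => e /lC[w [Aw _] wl].
    exists (fpow_coord w (Some i)) => //.
    by rewrite -fpow_coordB; exact: le_trans (fpow_coord_le _ _) wl.
  apply/ler_addgt0Pr => e /lC[w [_ wx] wl].
  have := ler_distD w l (fpow_const x); rewrite (distrC l w); lra.
have Cx : C (fpow_const x).
  split=> [i|]; first by rewrite fpow_constE; exact: Ax.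
  by rewrite subrr normr0 ltW.
have ss := penalty_sublinear m lf (ltW eta0) (ltW tau0).
have Nf1 u : - f u <= 1 * `|u|.
  have := dual_apply_le f u => /ler_normlP[h _].
  exact: le_trans h (ler_wpM2r (normr_ge0 u) f1).
have sL := penalty_le (m := m) (ltW eta0) (ltW tau0) ler01 Nf1.
have L0 : 0 < 1 + eta + tau * (m%:R * 2).
  have : 0 <= tau * (m%:R * 2) by rewrite mulr_ge0 ?(ltW tau0)// mulr_ge0.
  lra.
(* The distance estimate for [f] bounds [f (y - x)] through the distance to the intersection, which
   subtransversality bounds by [tau] times the sum of the distances to the [A i]. *)
have C_ge0 w : C w -> 0 <= penalty f eta tau (w - fpow_const x).
  move=> [Aw wx]; rewrite /penalty fpow_coordB fpow_constE.
  have := fpow_coord_le (w - fpow_const x) None.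
  rewrite fpow_coordB fpow_constE => /le_trans/(_ wx) w0.
  have := dP (fpow_coord w None) ltac:(lra).
  have := subA (fpow_coord w None).
  move: xr; rewrite -!ball_normE/= => xr.
  have := ler_distD x xbar (fpow_coord w None).
  rewrite (distrC x) => h /(_ ltac:(lra)).
  have : \sum_(i < m) dist (fpow_coord w None) (A i) <=
      \sum_(i < m) `|fpow_coord w None - x -
                     fpow_coord (w - fpow_const x) (Some i)|.
    apply: ler_sum => i _; rewrite fpow_coordB fpow_constE opprB addrA subrK.
    exact: dist_le.
  move=> /(ler_wpM2l (ltW tau0)); lra.
have [zh [phi [[Azh zhrho] zhx lphi phis phiC]]] := fuzzy_normal
  (fpow_geometrically_complete (@complete_geometrically_complete R X))
  (fpow_separable_dual_restrictions
     (asplund_separable_dual_restrictions asplundX))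
  clC Cx ss L0 sL C_ge0 e'0.
have Czh_add u : (forall i, A i (fpow_coord (zh + u) (Some i))) ->
    `|u| <= rho / 2 -> C (zh + u).
  move=> Au ur; split=> //; rewrite addrAC.
  by apply: le_trans (ler_normD _ _) _; lra.
pose phi_ o u := phi (fpow_single o u).
have lphi_ o : is_linear (phi_ o) by exact: is_linear_single.
have phi_coord o e : 0 < e -> exists2 d, 0 < d & forall u,
    (forall i, A i (fpow_coord (zh + fpow_single o u) (Some i))) ->
    `|u| < d -> - phi_ o u <= e * `|u|.
  move=> e0; have [d1 d10 d1P] := phiC e e0.
  exists (Num.min d1 (rho / 2)); first by rewrite lt_min d10; lra.
  move=> u Au; rewrite lt_min => /andP[ud1 ur].
  have Cu := Czh_add _ Au; rewrite fpow_norm_single in Cu.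
  have := d1P _ (Cu (ltW ur)); rewrite (addrC zh) addrK fpow_norm_single.
  by move=> /(_ ud1); rewrite /phi_; lra.
(* The coordinate [None] is locally unconstrained in [C], so both signs of [u] may be tested. *)
have phiN u : phi_ None u = 0.
  have le0 v : - phi_ None v <= 0.
    have lN : is_linear (fun v => - phi_ None v).
      by move=> a y z; rewrite (lphi_ None) opprD mulrN.
    apply/ler_addgt0Pr => e e0; rewrite add0r.
    have v1 : 0 < `|v| + 1 by have := normr_ge0 v; lra.
    have [d1 d10 d1P] := phi_coord None _ (divr_gt0 e0 v1).
    apply: le_trans (is_linear_bound_ball (d := d1 / 2)
      (c := e / (`|v| + 1)) lN _ _ v) _; first by lra.
      move=> y yd; apply: le_trans (d1P y _ _) _ => //.
      - by move=> i; rewrite fpow_coordD fpow_singleE addr0.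
      - by lra.
      - by rewrite ler_wpM2l// ltW// divr_gt0.
    by rewrite mulrAC ler_pdivrMr// ler_pM2l//; lra.
  apply/le_anti/andP; split; last by have := le0 u; lra.
  by have := le0 (- u); rewrite (is_linearN _ (lphi_ _)); lra.
have phi_le i u : phi_ (Some i) u <= (tau + e') * `|u|.
  have := phis (fpow_single (Some i) u); rewrite fpow_norm_single /penalty.
  rewrite !fpow_singleE/= is_linear0// normr0 oppr0 mulr0 add0r.
  rewrite (bigD1 i)//= fpow_singleE eqxx big1 => [|j ji].
    by rewrite sub0r normrN addr0 /phi_; lra.
  rewrite fpow_singleE; case: eqP => [[]/eqP|_]; first by rewrite (negPf ji).
  by rewrite subrr normr0.
(* On a vector supported at [Some i] the penalty is [tau] times the norm; dividing by [tau] gives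
   the bound [1 + e' / tau], at most [1 + eps]. *)
have /choice[g gP] i : exists g : dual X,
    (forall u, g u = - tau^-1 * phi_ (Some i) u) /\ `|g| <= 1 + eps.
  have [|||g gE g1] := @dual_of_bounded R X
      (fun u => - tau^-1 * phi_ (Some i) u) (1 + eps).
  - exact: is_linear_scale.
  - lra.
  - move=> u; have := phi_le i (- u).
    rewrite (is_linearN _ (lphi_ _)) normrN => h.
    rewrite mulNr -mulrN ler_pdivrMl//; apply: le_trans h _.
    have := ler_wpM2r (normr_ge0 u) e'tau; lra.
  - by exists g.
exists (tau *: \sum_i g i).
  exists (fun i => fpow_coord zh (Some i)).
    move=> i; split; first exact: Azh.
    have := fpow_coord_le (zh - fpow_const x) (Some i).
    rewrite fpow_coordB fpow_constE -ball_normE/= distrC; lra.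
  exists (\sum_i g i) => //; exists g => // i; have [gE g1] := gP i.
  split; last first.
    have eps1 : 0 < 1 + eps by lra.
    exists ((1 + eps)^-1 *: g i); last by rewrite scalerA divff ?gt_eqF// scale1r.
    rewrite /closed_unit_ball/= normrZ gtr0_norm ?invr_gt0//.
    by rewrite ler_pdivrMl// mulr1.
  apply/frechet_normal_coneP => e e0.
  have [d1 d10 d1P] := phi_coord (Some i) (tau * e) (mulr_gt0 tau0 e0).
  exists d1 => // y Ay yd; rewrite gE mulNr -mulrN ler_pdivrMl// mulrA.
  apply: d1P => // j; rewrite fpow_coordD fpow_singleE.
  case: eqP => [[->]|_]; first by rewrite addrC subrK.
  by rewrite addr0.
exists (f - tau *: \sum_i g i); last by rewrite addrC subrK.
exists (eps^-1 *: (f - tau *: \sum_i g i)); last first.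
  by rewrite scalerA divff ?gt_eqF// scale1r.
rewrite /closed_unit_ball/= normrZ gtr0_norm ?invr_gt0// ler_pdivrMl// mulr1.
have constE u : fpow_const u =
    fpow_single None u + \sum_(i < m) fpow_single (Some i) u.
  apply: fpow_eq => o; rewrite fpow_constE fpow_coordD fpow_coord_sum.
  rewrite fpow_singleE; case: o => [j|] /=; last first.
    by rewrite big1 ?addr0// => i _; rewrite fpow_singleE.
  rewrite (bigD1 j)//= fpow_singleE eqxx big1 ?addr0 ?add0r// => i ij.
  rewrite fpow_singleE; case: eqP => // -[] ji.
  by rewrite ji eqxx in ij.
have sumE u : (tau *: \sum_i g i : dual X) u = - phi (fpow_const u).
  rewrite -[LHS]/(tau * (\sum_i g i : dual X) u).
  rewrite (big_morph (fun h : dual X => (h : X -> R) u) (id1 := 0)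
    (op1 := +%R))//.
  rewrite constE (is_linearD _ _ lphi) (is_linear_sum _ _ _ lphi).
  rewrite -/(phi_ None u) phiN add0r.
  rewrite mulr_sumr -sumrN; apply: eq_bigr => i _.
  by have [-> _] := gP i; rewrite mulrA mulrN divff ?gt_eqF// mulN1r.
(* On the diagonal the coupling terms of the penalty vanish, leaving [- f u] and the errors [eta]
   and [e' * K], each at most [eps / 2]. *)
have bound u : f u + phi (fpow_const u) <= eps * `|u|.
  have := phis (fpow_const u); rewrite fpow_norm_const -/K /penalty.
  rewrite fpow_constE big1 => [|i _]; last by rewrite fpow_constE subrr normr0.
  by have := ler_wpM2r (normr_ge0 u) e'K; rewrite /eta; lra.
apply: dual_norm_le => u u1.
have -> : (f - tau *: \sum_i g i : dual X) u = f u + phi (fpow_const u).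
  by rewrite -[phi _]opprK -sumE.
have constN : fpow_const (- u) = - fpow_const u :> fpow (option 'I_m) X.
  apply: fpow_eq => o.
  by rewrite -[- fpow_const u]scaleN1r fpow_coordZ !fpow_constE scaleN1r.
have := bound u; have := bound (- u); rewrite constN normrN.
rewrite (is_linearN _ lf) (is_linearN _ lphi) => h1 h2.
have := ler_wpM2l (ltW eps0) u1; rewrite mulr1 => h3.
by rewrite ler_norml; apply/andP; split; lra.
Qed.
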